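(* Let $v\le w$ in $S_n$ and let $\mathcal C$ be a chain from $v$ to $w$. If $\mathcal N_{v,w}$ is toric, then the connected components of $G_{\mathcal C}$ are the sets of (pairwise distinct) vertices $\{a_1,\dots,a_k\}\subseteq[n]$ such that $v(a_i)=w(a_{i+1})$ for all $i=1,\dots,k-1$ and $v(a_k)=w(a_1)$.
   Context: $\le$ is the Bruhat order on $S_n$, $\ell$ is the Coxeter length, $x\lessdot y$ means $x<y$ and $\ell(y)=\ell(x)+1$, and $t_{a,b}$ is the transposition of $a$ and $b$. For a (saturated) chain $\mathcal C: v=u_0\lessdot u_1\lessdot\cdots\lessdot u_l=w$, the undirected graph $G_{\mathcal C}$ has vertex set $[n]$ and an edge $(a,b)$ whenever $u_{i+1}=u_it_{a,b}$ for some $0\le i\le l-1$. Let $B$ (resp. $B_-$) be the upper (resp. lower) triangular Borel subgroup of $G=GL_n(\mathbb C)$ and $T$ the diagonal torus. For $v\le w$ the Kazhdan-Lusztig variety is $\mathcal N_{v,w}=\overline{BwB/B}\cap B_-vB/B\subset G/B$; its dimension is $\ell(w)-\ell(v)$. The usual torus action is the action of $T$ by left multiplication. With $D^\circ(v)=\{(i,j): v(j)<i,\ v^{-1}(i)>j\}$, its weight cone is $\sigma_{v,w}=\mathrm{Cone}(e_{v(j)}-e_i : (i,j)\in D^\circ(v),\ t_{v(j),i}\,v\le w)\subset\mathbb R^n$. The complexity of $\mathcal N_{v,w}$ is $\dim\mathcal N_{v,w}-\dim\sigma_{v,w}$, and $\mathcal N_{v,w}$ is called toric if its complexity is $0$.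 *)

(* Defs.v *)
From HB Require Import structures.
From mathcomp Require Import all_boot all_order all_fingroup all_algebra.
From mathcomp Require Import all_classical all_reals all_analysis.
From mathcomp Require Import complex.

Set Implicit Arguments.
Unset Strict Implicit.
Unset Printing Implicit Defensive.

Import Order.TTheory GRing.Theory Num.Theory.

Local Open Scope classical_set_scope.
Local Open Scope ring_scope.

(* [n] = {1, .., n} is rendered as 'I_n, 0-indexed.  The library's product of permutations is (s * t) i = t (s i); the usual
   product of S_n is composition of functions, (perm_comp s t) i = s (t i). *)
Definition perm_comp n (s t : 'S_n) : 'S_n := (t * s)%g.

Definition simple_refl n : pred 'S_n :=
  fun s => [exists a : 'I_n, exists b : 'I_n,
             ((b : nat) == a.+1) && (s == tperm a b)].

Definition has_word n (w : 'S_n) : pred nat :=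
  fun k => [exists s : k.-tuple 'S_n,
             all (@simple_refl n) s && (foldr (@perm_comp n) 1%g s == w)].

Lemma has_wordP n (w : 'S_n) k :
  reflect (exists s : seq 'S_n, [/\ size s = k, all (@simple_refl n) s
             & foldr (@perm_comp n) 1%g s = w])
          (has_word w k).
Proof.
apply: (iffP existsP) => [[s /andP[sS /eqP sw]]|[s [sk sS sw]]].
  by exists s; split=> //; rewrite size_tuple.
by exists (tcast sk (in_tuple s)); rewrite val_tcast /= sS sw eqxx.
Qed.

Lemma foldr_perm_comp_cat n (s1 s2 : seq 'S_n) :
  foldr (@perm_comp n) 1%g (s1 ++ s2) =
  perm_comp (foldr (@perm_comp n) 1%g s1) (foldr (@perm_comp n) 1%g s2).
Proof.
elim: s1 => [|x s1 IH] /=; first by rewrite /perm_comp mulg1.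
by rewrite IH /perm_comp mulgA.
Qed.

Lemma has_word_exists n (w : 'S_n) : exists k, has_word w k.
Proof.
pose gen (x : 'S_n) := exists s : seq 'S_n,
  all (@simple_refl n) s /\ foldr (@perm_comp n) 1%g s = x.
suff [s [sS sw]] : gen w by exists (size s); apply/has_wordP; exists s.
have genM x y : gen x -> gen y -> gen (x * y)%g.
  move=> [s [sS <-]] [t [tS <-]]; exists (t ++ s).
  by rewrite all_cat tS sS foldr_perm_comp_cat.
have gen1 : gen 1%g by exists [::].
have genS (a b : 'I_n) : (b : nat) = a.+1 -> gen (tperm a b).
  move=> ab; exists [:: tperm a b]; split; last by rewrite /= /perm_comp mul1g.
  rewrite /= andbT; apply/existsP; exists a; apply/existsP; exists b.
  by rewrite ab !eqxx.
have genT d : forall a b : 'I_n, (b : nat) = (a + d)%N -> gen (tperm a b).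
  elim: d => [|d IH] a b; first by rewrite addn0 => /val_inj ->; rewrite tperm1.
  case: d IH => [_|d IH] ab; first by apply: genS; rewrite ab addn1.
  have cn : (a + d.+1 < n)%N by rewrite (leq_ltn_trans _ (ltn_ord b)) // ab leq_add2l.
  pose c := Ordinal cn.
  have ac : gen (tperm a c) by apply: IH.
  have cb : gen (tperm c b) by apply: genS; rewrite ab addnS.
  have -> : tperm a b = (tperm c b * tperm a c * tperm c b)%g.
    rewrite -{1}[tperm c b]tpermV -[RHS]/((_ ^-1 * _ * _)%g) -mulgA -conjgE tpermJ.
    rewrite tpermL tpermD //; apply/eqP => /(congr1 val) /=.
      by move/eqP; rewrite -[X in _ == X]addn0 eqn_add2l.
    by rewrite ab; move/eqP; rewrite -[X in _ == X]addn0 eqn_add2l.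
  by apply: (genM _ _ _ cb); apply: genM.
have [ts -> _] := prod_tpermP w.
elim: ts => [|[a b] ts IH]; first by rewrite big_nil.
rewrite big_cons; apply: genM => //=.
case: (leqP a b) => ab; first by apply: (genT (b - a)%N); rewrite subnKC.
by rewrite tpermC; apply: (genT (a - b)%N); rewrite subnKC // ltnW.
Qed.

Definition coxeter_length n (w : 'S_n) : nat := ex_minn (has_word_exists w).

Definition bruhat_step n : rel 'S_n := fun x y =>
  [exists a : 'I_n, exists b : 'I_n,
    [&& a != b, y == perm_comp x (tperm a b)
      & (coxeter_length x < coxeter_length y)%N]].

Definition bruhat n : rel 'S_n := connect (@bruhat_step n).

Definition bruhat_cover n : rel 'S_n := fun x y =>
  [&& x != y, bruhat x y & coxeter_length y == (coxeter_length x).+1].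

(* The chain v = u_0, u_1, .., u_l = w is given by v and us = [u_1; ..; u_l]. *)
Definition saturated_chain n (v : 'S_n) (us : seq 'S_n) (w : 'S_n) : bool :=
  path (@bruhat_cover n) v us && (last v us == w).

Definition chain_graph n (v : 'S_n) (us : seq 'S_n) : rel 'I_n := fun a b =>
  (a != b) &&
  has (fun p : 'S_n * 'S_n => p.2 == perm_comp p.1 (tperm a b)) (zip (v :: us) us).

Definition components (T : finType) (e : rel T) : {set {set T}} :=
  equivalence_partition (connect e) [set: T].

Record GL (K : fieldType) (n : nat) :=
  MkGL { GLval :> 'M[K]_n; GLvalP : GLval \in unitmx }.

HB.instance Definition _ K n := [isSub of GL K n for @GLval K n].
HB.instance Definition _ K n := [Choice of GL K n by <:].

Definition mulGL (K : fieldType) n (g h : GL K n) : GL K n :=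
  @MkGL K n (GLval g *m GLval h)
    (etrans (unitmx_mul _ _) (introT andP (conj (GLvalP g) (GLvalP h)))).

Lemma permGL_subproof (K : fieldType) n (w : 'S_n) :
  ((perm_mx w)^T : 'M[K]_n) \in unitmx.
Proof. by rewrite unitmx_tr unitmx_perm. Qed.

(* The permutation matrix with ones at the entries (w(j), j), i.e. mapping the
   basis column vector e_j to e_{w(j)}; the library's perm_mx is its transpose. *)
Definition permGL (K : fieldType) n (w : 'S_n) : GL K n :=
  MkGL (permGL_subproof K w).

Inductive polyfun (K : fieldType) n : ('M[K]_n -> K) -> Prop :=
| PolyConst c : polyfun (fun=> c)
| PolyCoord i j : polyfun (fun g => g i j)
| PolyAdd f g : polyfun f -> polyfun g -> polyfun (fun x => f x + g x)
| PolyMul f g : polyfun f -> polyfun g -> polyfun (fun x => f x * g x).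

(* Regular functions on GL_n are of the form f / det^k with f polynomial, so
   polynomials in the entries suffice to cut out the closed sets. *)
Definition zariski_closed (K : fieldType) n (Z : set (GL K n)) : Prop :=
  exists2 F : set ('M[K]_n -> K), (forall f, F f -> polyfun f) &
    Z = [set g : GL K n | forall f, F f -> f g = 0].

Definition zariski_open (K : fieldType) n (U : set (GL K n)) : Prop :=
  zariski_closed (~` U).

Lemma zariski_openT (K : fieldType) n : zariski_open [set: GL K n].
Proof.
exists [set (fun=> 1)]; first by move=> f ->; exact: PolyConst.
rewrite setCT; apply/seteqP; split=> // g /(_ _ erefl) /eqP.
by rewrite oner_eq0.
Qed.

Lemma zariski_openI (K : fieldType) n : setI_closed (@zariski_open K n).
Proof.
move=> U V [F Fp FE] [G Gp GE].
exists [set h | exists f g, [/\ F f, G g & h = fun x => f x * g x]].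
  by move=> h [f [g [Ff Gg ->]]]; apply: PolyMul; [apply: Fp|apply: Gp].
rewrite setCI FE GE; apply/seteqP; split=> x /=.
  case=> H h [f [g [Ff Gg ->]]]; first by rewrite (H f Ff) mul0r.
  by rewrite (H g Gg) mulr0.
move=> H; apply: contrapT => /not_orP[].
move=> /existsNP[f /not_implyP[Ff /eqP fx]] /existsNP[g /not_implyP[Gg /eqP gx]].
have /eqP := H _ (ex_intro _ f (ex_intro _ g (And3 Ff Gg erefl))).
by rewrite mulf_eq0 (negPf fx) (negPf gx).
Qed.

Lemma zariski_open_bigU (K : fieldType) n (I : Type) (U : I -> set (GL K n)) :
  (forall i, zariski_open (U i)) -> zariski_open (\bigcup_i U i).
Proof.
move=> Uo; exists [set f | polyfun f /\
    exists i, forall x, (~` U i) x -> f (GLval x) = 0]; first by move=> f [].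
rewrite setC_bigcup; apply/seteqP; split=> x /=.
  by move=> H f [_ [i fi]]; apply/fi/H.
move=> H i _; have [F Fp FE] := Uo i.
have FEy y : (~ U i y) = forall f, F f -> f (GLval y) = 0.
  by rewrite -[LHS]/((~` U i) y) FE.
rewrite /setC /= FEy => f Ff; apply: H; split; first exact: Fp.
by exists i => y; rewrite FEy; apply.
Qed.

HB.instance Definition _ (K : fieldType) n :=
  @isOpenTopological.Build (GL K n) (@zariski_open K n)
    (@zariski_openT K n) (@zariski_openI K n) (@zariski_open_bigU K n).

(* The library's is_trig_mx means lower triangular. *)
Definition borel (K : fieldType) n : set (GL K n) :=
  [set b | is_trig_mx (GLval b)^T].

Definition opp_borel (K : fieldType) n : set (GL K n) :=
  [set b | is_trig_mx (GLval b)].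

Definition borel_coset (K : fieldType) n (g : GL K n) : set (GL K n) :=
  [set mulGL g b | b in @borel K n].

Definition same_coset (K : fieldType) n : rel (GL K n) :=
  fun g h => `[< borel_coset g = borel_coset h >].

Lemma same_coset_refl (K : fieldType) n : reflexive (@same_coset K n).
Proof. by move=> g; apply/asboolP. Qed.

Lemma same_coset_sym (K : fieldType) n : symmetric (@same_coset K n).
Proof. by move=> g h; apply/asboolP/asboolP. Qed.

Lemma same_coset_trans (K : fieldType) n : transitive (@same_coset K n).
Proof. by move=> h g k /asboolP gh /asboolP hk; apply/asboolP; rewrite gh. Qed.

Canonical same_coset_equiv (K : fieldType) n : equiv_rel (GL K n) :=
  EquivRel (@same_coset K n) (@same_coset_refl K n) (@same_coset_sym K n)
    (@same_coset_trans K n).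

Definition flag (K : fieldType) n : topologicalType :=
  quotient_topology {eq_quot (@same_coset_equiv K n)}%qT.

Definition to_flag (K : fieldType) n (g : GL K n) : flag K n :=
  (\pi_{eq_quot (@same_coset_equiv K n)} g)%qT.

(* BwB/B and B_- v B/B *)
Definition schubert_cell (K : fieldType) n (w : 'S_n) : set (flag K n) :=
  [set to_flag (mulGL b (permGL K w)) | b in @borel K n].

Definition opp_schubert_cell (K : fieldType) n (v : 'S_n) : set (flag K n) :=
  [set to_flag (mulGL b (permGL K v)) | b in @opp_borel K n].

Arguments schubert_cell K {n} w.
Arguments opp_schubert_cell K {n} v.

Definition kl_variety (K : fieldType) n (v w : 'S_n) : set (flag K n) :=
  closure (schubert_cell K w) `&` opp_schubert_cell K v.

Arguments kl_variety K {n} v w.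

Definition irreducible_set (T : topologicalType) (Z : set T) : Prop :=
  Z !=set0 /\
  forall F1 F2 : set T, closed F1 -> closed F2 ->
    Z `<=` F1 `|` F2 -> Z `<=` F1 \/ Z `<=` F2.

Definition closed_in (T : topologicalType) (A Z : set T) : Prop :=
  exists2 F : set T, closed F & Z = F `&` A.

Definition irreducible_chain (T : topologicalType) (A : set T) (k : nat)
    (Z : nat -> set T) : Prop :=
  (forall i, (i <= k)%N -> irreducible_set (Z i) /\ closed_in A (Z i)) /\
  (forall i, (i < k)%N -> Z i `<` Z i.+1).

Definition krull_dim (R : realType) (T : topologicalType) (A : set T) : \bar R :=
  ereal_sup [set (k%:R)%:E | k in [set k | exists Z, irreducible_chain A k Z]].

Definition opp_diagram n (v : 'S_n) : {set 'I_n * 'I_n} :=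
  [set p : 'I_n * 'I_n | (v p.2 < p.1)%N && (p.2 < (v^-1)%g p.1)%N].

Definition cone (R : realType) (V : lmodType R) (I : finType) (A : {set I})
    (x : I -> V) : set V :=
  [set y | exists2 c : I -> R, (forall i, 0 <= c i) &
           y = \sum_(i in A) c i *: x i].

Definition weight_cone (R : realType) n (v w : 'S_n) : set 'rV[R]_n :=
  cone [set p in opp_diagram v | bruhat (perm_comp (tperm (v p.2) p.1) v) w]
       (fun p => 'e_(v p.2) - 'e_(p.1)).

Arguments weight_cone R {n} v w.

(* The dimension of the linear span of S, as the largest number of linearly
   independent vectors of S. *)
Definition cone_dim (R : realType) n (S : set 'rV[R]_n) : nat :=
  \max_(k < n.+1 | `[< exists X : k.-tuple 'rV[R]_n,
                        free X /\ forall x, x \in X -> S x >]) k.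

Definition kl_complexity (R : realType) n (v w : 'S_n) : \bar R :=
  (krull_dim R (kl_variety R[i] v w) - (cone_dim (weight_cone R v w))%:R%:E)%E.

Arguments kl_complexity R {n} v w.

Definition kl_toric (R : realType) n (v w : 'S_n) : Prop :=
  kl_complexity R v w = 0%E.

Arguments kl_toric R {n} v w.

(* Main.v *)
Require Import Defs.
From mathcomp Require Import all_boot all_fingroup all_algebra all_classical all_reals.
From mathcomp Require Import ereal topology complex.
From mathcomp Require Import zify ring.

Set Implicit Arguments.
Unset Strict Implicit.
Unset Printing Implicit Defensive.

(* Let l be the length of the chain and let the edge vectors be e_(v a) - e_(v b), for the l
   edges (a,b) of the chain graph.
   - Every reflection v t_(a,b) lying between v and w joins two vertices of the same component,
     so the edge vectors span a space containing the weight cone.  Indeed all saturated chains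
     from v to w have the same components: the middle of a diamond v < x < z is coloured
     compatibly with v as soon as z is, and diamond moves bring every chain to one that starts
     with a canonical atom depending only on v and w.
   - The Kazhdan-Lusztig variety has Krull dimension at least l: the closures of the
     Richardson pieces attached to the members of the chain form a strict chain of
     irreducible closed subsets.
   - Hence, if the variety is toric, the l edge vectors are linearly independent, and by
     Carter's lemma a function fixed by the product v^-1 w of the transpositions is constant
     along every edge.  So the components are the orbits of v^-1 w. *)

(** * Length and covers *)

Section Length.
Variable n : nat.
Implicit Types (u v w x y z : 'S_n) (a b c i j k : 'I_n).

Definition inversions u :=
  #|[set p : 'I_n * 'I_n | (p.1 < p.2) && (u p.2 < u p.1)]|.

Lemma ord_eqE (a b : 'I_n) : (a == b) = (nat_of_ord a == nat_of_ord b).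
Proof. by []. Qed.

Lemma perm_compE u v i : perm_comp u v i = u (v i).
Proof. by rewrite permE. Qed.

Lemma perm_compA : associative (@perm_comp n).
Proof. by move=> u v w; rewrite /perm_comp mulgA. Qed.

Lemma perm_comp_tpermK u a b :
  perm_comp (perm_comp u (tperm a b)) (tperm a b) = u.
Proof. by rewrite /perm_comp mulgA tperm2 mul1g. Qed.

Lemma tperm_3cycle v i j k : i != j -> k != j -> i != k ->
  perm_comp (perm_comp v (tperm i j)) (tperm i k) =
  perm_comp (perm_comp v (tperm i k)) (tperm k j).
Proof.
move=> ij kj ik; rewrite /perm_comp !mulgA; congr (_ * _)%g.
by rewrite [RHS]conjgC tpermJ tpermR tpermD // eq_sym.
Qed.

Lemma tperm_disjoint v a b j k : j != a -> j != b -> k != a -> k != b ->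
  perm_comp (perm_comp v (tperm a b)) (tperm j k) =
  perm_comp (perm_comp v (tperm j k)) (tperm a b).
Proof.
move=> ja jb ka kb; rewrite /perm_comp !mulgA; congr (_ * _)%g.
by rewrite [RHS]conjgC tpermJ !tpermD // eq_sym.
Qed.

Lemma tperm_triple v i j k : i != j -> k != j -> i != k ->
  perm_comp v (tperm i j) =
  perm_comp (perm_comp (perm_comp v (tperm i k)) (tperm k j)) (tperm i k).
Proof.
move=> ij kj ik; rewrite -tperm_3cycle // perm_comp_tpermK //.
Qed.

Lemma perm_neq u a b : a != b -> (u a : nat) != u b.
Proof. by apply: contraNneq => /val_inj /perm_inj ->. Qed.

(** Swapping [a] and [b] in both coordinates carries the inversions of the new permutation other
    than [(a, b)] bijectively onto those of [u], because adjacent positions compare alike with every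
    third position. *)
Lemma inversions_adj u a b : b = a.+1 :> nat -> u a < u b ->
  inversions (perm_comp u (tperm a b)) = (inversions u).+1.
Proof.
move=> ab uab; rewrite /inversions.
have nab : a != b by apply/eqP => h; move: ab; rewrite h; lia.
set A := [set p | _]; set I := [set p | _ & u _ < u _].
have abA : (a, b) \in A by rewrite inE /= !perm_compE tpermL tpermR ab ltnSn.
rewrite (cardsD1 (a, b)) abA add1n; congr _.+1.
pose phi (p : 'I_n * 'I_n) := (tperm a b p.1, tperm a b p.2).
have phi_inj : injective phi.
  by move=> [p q] [p' q'] [/perm_inj -> /perm_inj ->].
rewrite -(card_preimset I phi_inj); apply: eq_card => -[p q].
rewrite !inE /= !perm_compE xpair_eqE.
have := perm_neq u nab.
case: (tpermP a b p) => [->|->|/eqP pa /eqP pb];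
  case: (tpermP a b q) => [->|->|/eqP qa /eqP qb];
  rewrite ?eqxx ?(negPf nab) ?[b == a]eq_sym ?(negPf nab) ?ltnn ?andbF //=;
  rewrite ?ord_eqE; move: uab ab;
  repeat match goal with h : is_true (_ != _) |- _ => move: h; rewrite ?ord_eqE end;
  lia.
Qed.

Definition up u a b := (a < b) && (u a < u b).

(** The point [(c, u c)] lies strictly inside the rectangle with corners [(a, u a)] and [(b, u b)].
    Emptiness of this rectangle is what makes a reflection a cover. *)
Definition between u a b c := (a < c < b) && (u a < u c < u b).

(** Induction on [b - a], writing t_(a,b) = t_(a,c) t_(c,b) t_(a,c) with [c = a + 1]. Each outer
    factor changes the count by one: in opposite directions if [u c] lies outside the interval from
    [u a] to [u b], both upwards if [c] is in between. The middle factor is the induction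
    hypothesis. *)
Lemma inversions_up_between u a b (u' := perm_comp u (tperm a b)) : up u a b ->
  inversions u < inversions u' /\
  ((forall c, ~~ between u a b c) -> inversions u' = (inversions u).+1).
Proof.
rewrite {}/u' => /andP[]; have [d] := ubnP (b - a); elim: d u a b => // d IH u a b db ab uab.
have [E|ne] := eqVneq (b : nat) a.+1; first by rewrite inversions_adj.
have cn : a.+1 < n by have := ltn_ord b; lia.
pose c := Ordinal cn; have ac : c = a.+1 :> nat by [].
have nac : a != c by apply/eqP => /(congr1 val) /=; lia.
have ncb : c != b by apply/eqP => /(congr1 val) /=; lia.
have nab : a != b by apply/eqP => h; move: ab; rewrite h; lia.
have acb : a < c < b by rewrite /=; lia.
rewrite (tperm_triple _ nab ncb nac).
set u1 := perm_comp u (tperm a c); set u2 := perm_comp u1 (tperm c b).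
have u1a : u1 a = u c by rewrite perm_compE tpermL.
have u1c : u1 c = u a by rewrite perm_compE tpermR.
have u1b : u1 b = u b by rewrite perm_compE tpermD.
have u2a : u2 a = u c by rewrite perm_compE tpermD // eq_sym.
have u2c : u2 c = u b by rewrite perm_compE tpermL u1b.
have [|||step2 exact2] := IH u1 c b; rewrite ?u1c ?u1b //=; try lia.
rewrite -/u2 in step2 exact2.
(* A position between [c] and [b] for [u1] is also between [a] and [b] for [u]. *)
have {}exact2 : (forall e, ~~ between u a b e) -> inversions u2 = (inversions u1).+1.
  move=> nb; apply: exact2 => e; apply: contra (nb e); rewrite /between u1c u1b.
  move=> /andP[/andP[ce eb]]; rewrite perm_compE tpermD ?ord_eqE //=; try lia.
have up1 := @inversions_adj u a c ac; have up2 := @inversions_adj u2 a c ac.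
rewrite -/u1 u2a u2c in up1 up2.
have := perm_neq u nac; rewrite neq_ltn => /orP[uac|uca].
  have {}up1 := up1 uac.
  have := perm_neq u ncb; rewrite neq_ltn => /orP[ucb|ubc].
    have {}up2 := up2 ucb; split; first by lia.
    by move=> /(_ c); rewrite /between acb uac ucb.
  have := @inversions_adj (perm_comp u2 (tperm a c)) a c ac.
  rewrite perm_comp_tpermK !(perm_compE u2) tpermL tpermR u2a u2c => /(_ ubc) down2.
  by split=> [|/exact2]; lia.
have {}up2 := up2 (ltn_trans uca uab).
have := @inversions_adj u1 a c ac; rewrite u1a u1c perm_comp_tpermK => /(_ uca) down1.
by split=> [|/exact2]; lia.
Qed.

Lemma inversions_up u a b : up u a b ->
  inversions u < inversions (perm_comp u (tperm a b)).
Proof. by case/inversions_up_between. Qed.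

Lemma simple_reflP x : reflect (exists a b, b = a.+1 :> nat /\ x = tperm a b) (simple_refl x).
Proof.
apply: (iffP existsP) => [[a /existsP[b /andP[/eqP ab /eqP ->]]]|[a [b [ab ->]]]].
  by exists a, b.
by exists a; apply/existsP; exists b; rewrite ab !eqxx.
Qed.

Lemma inversions_adj_le u a b : b = a.+1 :> nat ->
  inversions (perm_comp u (tperm a b)) <= (inversions u).+1.
Proof.
move=> ab; have nab : a != b by apply/eqP => h; move: ab; rewrite h; lia.
have := perm_neq u nab; rewrite neq_ltn => /orP[uab|uba].
  by rewrite inversions_adj.
have := @inversions_adj (perm_comp u (tperm a b)) a b ab.
by rewrite perm_comp_tpermK !perm_compE tpermL tpermR => /(_ uba) ->; lia.
Qed.

Lemma inversions1 : inversions 1 = 0.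
Proof.
apply/eqP; rewrite cards_eq0; apply/eqP/setP => -[p q].
by rewrite !inE !perm1 /=; lia.
Qed.

Lemma foldr_perm_comp_rcons (s : seq 'S_n) x :
  foldr (@perm_comp n) 1%g (rcons s x) = perm_comp (foldr (@perm_comp n) 1%g s) x.
Proof. by rewrite -cats1 foldr_perm_comp_cat /= [perm_comp x _]mul1g. Qed.

Lemma inversions_word (s : seq 'S_n) : all (@simple_refl n) s ->
  inversions (foldr (@perm_comp n) 1%g s) <= size s.
Proof.
elim/last_ind: s => [_|s x IH]; first by rewrite /= inversions1.
rewrite all_rcons => /andP[/simple_reflP[a [b [ab ->]]] /IH h].
rewrite size_rcons foldr_perm_comp_rcons.
by apply: leq_trans (inversions_adj_le _ ab) _; rewrite ltnS.
Qed.

Lemma increasing_perm_ge u : (forall a b, b = a.+1 :> nat -> u a < u b) ->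
  forall a, a <= u a.
Proof.
move=> inc a; have [m] := ubnP a; elim: m a => // m IH a am.
case E : (a : nat) => [|p] //.
have pn : p < n by have := ltn_ord a; lia.
apply: leq_ltn_trans (inc (Ordinal pn) a E); apply: (IH (Ordinal pn)).
by rewrite /=; lia.
Qed.

(** The inverse is increasing too, so neither [u] nor its inverse moves a position down, which
    leaves only the identity. *)
Lemma increasing_perm u : (forall a b, b = a.+1 :> nat -> u a < u b) -> u = 1%g.
Proof.
move=> inc.
have mono d a b : b = a + d.+1 :> nat -> u a < u b.
  elim: d b => [|d IH] b ab; first by apply: inc; rewrite ab addn1.
  have cn : a + d.+1 < n by have := ltn_ord b; lia.
  by apply: ltn_trans (IH (Ordinal cn) erefl) (inc _ _ _); rewrite /= ab addnS.
have ge := increasing_perm_ge inc.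
apply/permP => i; rewrite perm1; apply/val_inj/eqP; rewrite eqn_leq ge andbT leqNgt.
apply/negP => iui.
have iinc a b : b = a.+1 :> nat -> (u^-1)%g a < (u^-1)%g b.
  move=> ab; rewrite ltnNge; apply/negP; rewrite leq_eqVlt => /orP[/eqP/val_inj/perm_inj h|h].
    by move: ab; rewrite h; lia.
  have := @mono ((u^-1)%g a - ((u^-1)%g b).+1) ((u^-1)%g b) ((u^-1)%g a).
  by rewrite !permKV ab => /(_ _); lia.
by have := increasing_perm_ge iinc (u i); rewrite permK leqNgt => /negP; apply.
Qed.

(** Bubble sort: undoing a descent at adjacent positions removes one inversion, and a permutation
    without such descents is the identity. *)
Lemma has_word_inversions u : has_word u (inversions u).
Proof.
have [m] := ubnP (inversions u); elim: m u => // m IH u um.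
have [/existsP[a /existsP[b /andP[/eqP ab uba]]]|noinv] :=
  boolP [exists a : 'I_n, exists b : 'I_n, (b == a.+1 :> nat) && (u b < u a)].
  have := @inversions_adj (perm_comp u (tperm a b)) a b ab.
  rewrite perm_comp_tpermK !perm_compE tpermL tpermR => /(_ uba) E.
  have /has_wordP[s [sz sS sw]] := IH (perm_comp u (tperm a b)) ltac:(lia).
  apply/has_wordP; exists (rcons s (tperm a b)); split.
  - by rewrite size_rcons sz.
  - by rewrite all_rcons sS andbT; apply/simple_reflP; exists a, b.
  - by rewrite foldr_perm_comp_rcons sw perm_comp_tpermK.
have -> : u = 1%g.
  apply: increasing_perm => a b ab; rewrite ltn_neqAle perm_neq /=; last first.
    by apply/eqP => h; move: ab; rewrite h; lia.
  rewrite leqNgt; apply: contra noinv => uba.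
  by apply/existsP; exists a; apply/existsP; exists b; rewrite ab eqxx.
by rewrite inversions1; apply/has_wordP; exists [::].
Qed.

Lemma coxeter_lengthE u : coxeter_length u = inversions u.
Proof.
rewrite /coxeter_length; case: ex_minnP => m /has_wordP[s [<- sS <-]] mmin.
by apply/eqP; rewrite eqn_leq inversions_word // mmin // has_word_inversions.
Qed.

(** If the values at the two positions decreased, [inversions_up] applied to the other endpoint
    would make the length drop; so the length condition can be read off from positions and
    values. *)
Lemma bruhat_stepP x y :
  reflect (exists a b, up x a b /\ y = perm_comp x (tperm a b)) (bruhat_step x y).
Proof.
apply: (iffP existsP) => [[a /existsP[b /and3P[ab /eqP -> ]]]|[a [b [xab ->]]]].
  have main (c d : 'I_n) : c < d ->
      coxeter_length x < coxeter_length (perm_comp x (tperm c d)) -> up x c d.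
    move=> cd h; have ncd : c != d by rewrite ord_eqE neq_ltn cd.
    rewrite /up cd ltn_neqAle (perm_neq _ ncd) leqNgt /=.
    apply/negP => xdc; have := @inversions_up (perm_comp x (tperm c d)) c d.
    rewrite /up perm_comp_tpermK !perm_compE tpermL tpermR cd xdc => /(_ isT).
    by rewrite -!coxeter_lengthE; lia.
  move: ab; rewrite -val_eqE neq_ltn => /orP[ab|ba] h; first by exists a, b; split=> //; apply: main.
  by exists b, a; rewrite tpermC; split=> //; apply: main => //; rewrite tpermC.
exists a; apply/existsP; exists b; rewrite eqxx !coxeter_lengthE inversions_up // andbT andbT.
by case/andP: xab => ab _; apply/eqP => e; rewrite e ltnn in ab.
Qed.

Lemma up_bruhat_step x a b : up x a b -> bruhat_step x (perm_comp x (tperm a b)).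
Proof. by move=> h; apply/bruhat_stepP; exists a, b. Qed.

Lemma bruhat_step_length x y : bruhat_step x y -> coxeter_length x < coxeter_length y.
Proof. by case/existsP => a /existsP[b /and3P[]]. Qed.

Lemma bruhat_ind (P : 'S_n -> Prop) w :
  P w -> (forall x y, bruhat_step x y -> bruhat y w -> P y -> P x) ->
  forall v, bruhat v w -> P v.
Proof.
move=> Pw PS v /connectP[p]; elim: p v => [v _ /= <- //|y p IH v /= /andP[vy yp] E].
by apply: (PS _ y) => //; [apply/connectP; exists p|apply: IH].
Qed.

Lemma bruhat_refl x : bruhat x x. Proof. exact: connect0. Qed.
Lemma bruhat_trans : transitive (@bruhat n). Proof. exact: connect_trans. Qed.
Lemma bruhat_step1 x y : bruhat_step x y -> bruhat x y. Proof. exact: connect1. Qed.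

Lemma bruhat_length v w : bruhat v w ->
  v = w \/ coxeter_length v < coxeter_length w.
Proof.
move: v; apply: bruhat_ind => [|x y /bruhat_step_length xy _ [<-|yw]]; [by left|by right|].
by right; apply: ltn_trans xy yw.
Qed.

Lemma bruhat_coverP x y : reflect
  (bruhat_step x y /\ coxeter_length y = (coxeter_length x).+1) (bruhat_cover x y).
Proof.
apply: (iffP and3P) => [[xy + /eqP E]|[xy E]].
  case/connectP => -[|z p] /= => [_ e|/andP[xz zp] e]; first by rewrite e eqxx in xy.
  have zy : bruhat z y by apply/connectP; exists p.
  by have := bruhat_step_length xz; case: (bruhat_length zy) => [zE _|]; [rewrite -zE in E *; split|lia].
by rewrite bruhat_step1 // E eqxx; split=> //; apply/eqP => h; move: E; rewrite h; lia.
Qed.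

Lemma bruhat_cover_step x y : bruhat_cover x y -> bruhat_step x y.
Proof. by case/bruhat_coverP. Qed.

Lemma bruhat_step2_cover x y z : bruhat_step x y -> bruhat_step y z ->
  coxeter_length z = (coxeter_length x).+2 -> bruhat_cover x y /\ bruhat_cover y z.
Proof.
move=> xy yz E; have := bruhat_step_length xy; have := bruhat_step_length yz.
by split; apply/bruhat_coverP; split=> //; lia.
Qed.

(** Each of the three factors of [tperm_triple] goes up when [c] is in between. Such a reflection
    therefore raises the length by at least three and is no cover. *)
Lemma between_steps x a b c : up x a b -> between x a b c ->
  [/\ bruhat_step x (perm_comp x (tperm a c)),
      bruhat_step (perm_comp x (tperm a c)) (perm_comp (perm_comp x (tperm a c)) (tperm c b)) &
      bruhat_step (perm_comp (perm_comp x (tperm a c)) (tperm c b)) (perm_comp x (tperm a b))].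
Proof.
move=> /andP[ab xab] /andP[/andP[ac cb] /andP[xac xcb]].
have nac : a != c by rewrite ord_eqE neq_ltn ac.
have ncb : c != b by rewrite ord_eqE neq_ltn cb.
have nab : a != b by rewrite ord_eqE neq_ltn ab.
split.
- by apply: up_bruhat_step; rewrite /up ac.
- by apply: up_bruhat_step; rewrite /up cb !perm_compE tpermR tpermD.
- rewrite (tperm_triple _ nab ncb nac); apply: up_bruhat_step.
  rewrite /up ac !perm_compE tpermL [tperm c b a]tpermD 1?eq_sym // tpermL.
  by rewrite [tperm a c b]tpermD.
Qed.

Lemma cover_not_between x a b c : up x a b -> bruhat_cover x (perm_comp x (tperm a b)) ->
  ~~ between x a b c.
Proof.
move=> upx /bruhat_coverP[_ E]; apply/negP => /(between_steps upx)[s1 s2 s3].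
have := bruhat_step_length s1; have := bruhat_step_length s2.
have := bruhat_step_length s3; rewrite {}E; clear; lia.
Qed.

End Length.

(** * Diamond moves *)

Section Chains.
Variable n : nat.
Implicit Types (u v w x y z : 'S_n) (a b c i j k : 'I_n) (us : seq 'S_n).

Lemma ltn_neq a b : a < b -> a != b.
Proof. by rewrite ord_eqE neq_ltn => ->. Qed.

Definition agree v w j := forall i, i < j -> v i = w i.

(** A step raises the value at the first position it changes, so the lexicographic order on one-line
    words extends the Bruhat order. *)
Lemma bruhat_lex v w : bruhat v w -> v = w \/ exists2 a, agree v w a & v a < w a.
Proof.
move: v; apply: bruhat_ind => [|x y /bruhat_stepP[a [b [/andP[ab xab] ->]]] _ IH]; first by left.
set y' := perm_comp x _ in IH *.
have agr : agree x y' a.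
  by move=> i ia; rewrite perm_compE tpermD // ord_eqE; lia.
have lt : x a < y' a by rewrite perm_compE tpermL.
right; case: IH => [<-|[c yc ltc]]; first by exists a.
have [ac|ca|/val_inj E] := ltngtP a c.
- by exists a; [move=> i ia; rewrite agr // yc // (ltn_trans ia)|rewrite -yc].
- by exists c; [move=> i ic; rewrite agr ?yc // (ltn_trans ic)|rewrite agr].
- by rewrite -E in yc ltc; exists a; [move=> i ia; rewrite agr ?yc|apply: ltn_trans ltc].
Qed.

(** Lexicographically, [u] is squeezed between two words with a common prefix. *)
Lemma bruhat_agree v u w j : bruhat v u -> bruhat u w -> agree v w j -> agree v u j.
Proof.
move=> /bruhat_lex[-> //|[a vua ltva]] uw vw i ij.
have [ia|ai] := ltnP i a; first exact: vua.
have vwa : v a = w a by apply: vw; apply: leq_ltn_trans ij.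
case: (bruhat_lex uw) => [uwE|[c uwc ltuc]]; first by rewrite vwa uwE ltnn in ltva.
have [ca|ac|/val_inj E] := ltngtP c a.
- by move: ltuc; rewrite -vua // vw ?ltnn // (ltn_trans ca) // (leq_ltn_trans ai).
- by move: ltva; rewrite uwc // vwa ltnn.
- by move: ltuc; rewrite E => /(ltn_trans ltva); rewrite vwa ltnn.
Qed.

Lemma bruhat_agree_le v w j : bruhat v w -> agree v w j -> v j <= w j.
Proof.
case/bruhat_lex => [-> //|[a vwa ltva] vw].
have [ja|aj|/val_inj ->] := ltngtP j a; [by rewrite vwa|by rewrite vw // ltnn in ltva|exact: ltnW].
Qed.

(** Here [j] is the first position where [v] and [w] differ, and [k] the first later one whose value
    in [v] exceeds [v j] without exceeding [w j]. The pair depends on [v] and [w] only, and v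
    t_(j,k) is the canonical atom. *)
Definition canonical v w j k :=
  [/\ agree v w j, j < k, v j < v k <= w j &
      forall k', j < k' -> v j < v k' <= w j -> k <= k'].

Lemma canonical_exists v w : bruhat v w -> v != w -> exists j k, canonical v w j k.
Proof.
move=> /bruhat_lex[->|[j vw ltj] _]; first by rewrite eqxx.
(* The position of the value [w j] in [v] is a candidate for [k]: it lies to the right of [j], since
   [v] and [w] agree to the left. So the minimum exists. *)
pose k0 := (v^-1)%g (w j); have vk0 : v k0 = w j by rewrite permKV.
pose P k := (j < k) && (v j < v k <= w j).
have Pk0 : P k0.
  rewrite /P vk0 ltj leqnn !andbT ltnNge leq_eqVlt; apply/negP => /orP[/eqP/val_inj E|k0j].
    by move: ltj; rewrite -vk0 E ltnn.
  by have /= := vw _ k0j; rewrite vk0 => /perm_inj E; rewrite E ltnn in k0j.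
case: (@arg_minnP _ k0 P val Pk0) => k /andP[jk vk] kmin.
by exists j, k; split=> // k' jk' vk'; apply: kmin; rewrite /P jk' vk'.
Qed.

Lemma canonical_lt v w j k : canonical v w j k -> v j < w j.
Proof. by case=> _ _ /andP[h1 h2] _; apply: leq_trans h2. Qed.

Lemma canonical_unique v w j k j' k' :
  canonical v w j k -> canonical v w j' k' -> j = j' /\ k = k'.
Proof.
move=> ck ck'; have E : j = j'.
  case: (ltngtP j j') => [jj|jj|/val_inj //].
    by have := canonical_lt ck; have [h _ _ _] := ck'; rewrite h // ltnn.
  by have := canonical_lt ck'; have [h _ _ _] := ck; rewrite h // ltnn.
split=> //; rewrite -{}E in ck'; case: ck => _ jk vk kmin; case: ck' => _ jk' vk' kmin'.
by apply/val_inj/eqP; rewrite eqn_leq kmin ?kmin'.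
Qed.

Lemma saturated_chain_cons v u us w :
  saturated_chain v (u :: us) w = bruhat_cover v u && saturated_chain u us w.
Proof. by rewrite /saturated_chain /= andbA. Qed.

Lemma saturated_chain_cat v us u us' w :
  saturated_chain v us u -> saturated_chain u us' w -> saturated_chain v (us ++ us') w.
Proof.
rewrite /saturated_chain cat_path last_cat => /andP[-> /eqP ->].
by case/andP => -> ->.
Qed.

Lemma saturated_chain_bruhat v us w : saturated_chain v us w -> bruhat v w.
Proof.
elim: us v => [|u us IH] v; first by case/andP => _ /eqP /= ->; exact: bruhat_refl.
rewrite saturated_chain_cons => /andP[/bruhat_cover_step vu /IH].
by apply: bruhat_trans; exact: bruhat_step1.
Qed.

Lemma saturated_chain_length v us w : saturated_chain v us w ->
  coxeter_length w = coxeter_length v + size us.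
Proof.
elim: us v => [|u us IH] v; first by case/andP => _ /eqP /= ->; rewrite addn0.
by rewrite saturated_chain_cons => /andP[/bruhat_coverP[_ vu] /IH ->]; rewrite vu addSnnS.
Qed.

Lemma saturated_chain_size v us us' w :
  saturated_chain v us w -> saturated_chain v us' w -> size us = size us'.
Proof.
move=> /saturated_chain_length E /saturated_chain_length E'.
by apply: (@addnI (coxeter_length v)); rewrite -E -E'.
Qed.

(** * Colourings of positions along a chain *)

Section Colouring.
Variables (T : eqType) (f : 'I_n -> T).

Definition colour u := [ffun i => f ((u^-1)%g i)].

(** For a chain, this says that every edge joins two positions of the same colour. *)
Definition compatible v us := all (fun u => colour u == colour v) us.

Lemma colourP u v : reflect (forall i, f ((u^-1)%g i) = f ((v^-1)%g i)) (colour u == colour v).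
Proof.
apply: (iffP eqP) => [E i|E]; last by apply/ffunP => i; rewrite !ffunE.
by have := congr1 (fun g : {ffun _} => g i) E; rewrite !ffunE.
Qed.

Lemma colour_tperm v a b :
  (colour (perm_comp v (tperm a b)) == colour v) = (f a == f b).
Proof.
apply/colourP/eqP => [/(_ (v b))|E i]; rewrite /perm_comp invMg permM tpermV.
  by rewrite permK tpermR.
by case: tpermP => [->|->|].
Qed.

(** With x = v t_(a,b) and z = x t_(c,d), the colouring [f] is invariant under t_(a,b) t_(c,d). If
    t_(c,d) fixes [a] or [b], this gives [f a = f b]; otherwise the two transpositions coincide and
    z = v, against the lengths. *)
Lemma diamond_colour v x z : bruhat_step v x -> bruhat_step x z ->
  colour z == colour v -> colour x == colour v.
Proof.
move=> vx xz; have vz : v != z.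
  apply/eqP => vz; have := bruhat_step_length vx; have := bruhat_step_length xz.
  by rewrite -vz; lia.
have [a [b [_ xE]]] := bruhat_stepP _ _ vx; have [c [d [_ zE]]] := bruhat_stepP _ _ xz.
rewrite zE xE colour_tperm => /colourP E; move: vz; rewrite zE xE => vz.
have {}E i : f (tperm a b (tperm c d i)) = f i.
  have := E (perm_comp (perm_comp v (tperm a b)) (tperm c d) i).
  by rewrite permK !perm_compE permK.
have Ea := E (tperm c d a); have Eb := E (tperm c d b).
rewrite !tpermK tpermL tpermR in Ea Eb.
move: Ea Eb vz; case: (tpermP c d a) => [->|->|_ _ -> //];
  case: (tpermP c d b) => [->|->|_ _ _ -> //]; rewrite ?tperm1 ?eqxx //.
  by rewrite perm_comp_tpermK eqxx.
by rewrite [tperm d c]tpermC perm_comp_tpermK eqxx.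
Qed.

Lemma compatible_cons v u us :
  compatible v (u :: us) = (colour u == colour v) && compatible u us.
Proof. by rewrite /compatible /=; case: eqP => // ->. Qed.

Lemma compatible_diamond v x x' z us :
  bruhat_step v x -> bruhat_step x z -> bruhat_step v x' -> bruhat_step x' z ->
  compatible v (x :: z :: us) = compatible v (x' :: z :: us).
Proof.
move=> vx xz vx' xz'; rewrite /compatible /=.
case E : (colour z == colour v); last by rewrite !andbF.
by rewrite (diamond_colour vx xz E) (diamond_colour vx' xz' E).
Qed.

(** The outcome of the diamond moves: [us] can be traded for a chain through the canonical atom
    without affecting compatibility. *)
Definition canonical_start v w us := exists j k us', let u := perm_comp v (tperm j k) in
  [/\ canonical v w j k, saturated_chain v (u :: us') w &
      compatible v us = compatible v (u :: us')].

(** The first edge already moves [j], to some [b]. If [b] is not [k], minimality of [k] and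
    emptiness of the rectangle give [k < b] and [v b < v k]. Then [(j, k)] is also the canonical
    pair of [u] and [w], so the tail may be assumed to start with it, and t_(j,b) t_(j,k) = t_(j,k)
    t_(k,b) supplies the diamond through the canonical atom of [v]. *)
Lemma canonical_start_first v w j k b us (u := perm_comp v (tperm j b)) :
  canonical v w j k -> up v j b -> saturated_chain v (u :: us) w ->
  (us != [::] -> canonical_start u w us) -> canonical_start v w (u :: us).
Proof.
move=> can upb sat IH; have [vw jk /andP[vjk vkw] kmin] := can.
have := sat; rewrite saturated_chain_cons => /andP[vu satu].
have uw := saturated_chain_bruhat satu; have [jb vjb] := andP upb.
have ujE : u j = v b by rewrite perm_compE tpermL.
have uagr : agree u w j.
  by move=> i ij; rewrite perm_compE tpermD ?vw // ord_eqE; lia.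
have vbw : v b <= w j by rewrite -ujE; exact: bruhat_agree_le.
have [kb|nkb] := eqVneq k b; first by exists j, k, us; rewrite kb in can *.
have {}kb : k < b.
  by have := kmin b jb; rewrite vjb vbw ltn_neqAle => -> //; rewrite andbT.
have njk := ltn_neq jk.
have njb := ltn_neq jb.
have vbk : v b < v k.
  rewrite ltn_neqAle perm_neq 1?eq_sym //= leqNgt.
  by have := cover_not_between k upb vu; rewrite /between jk kb vjk.
have other i : i != j -> i != b -> u i = v i.
  by move=> ij ib; rewrite perm_compE tpermD // eq_sym.
have ukE : u k = v k by rewrite other // eq_sym.
have us0 : us != [::].
  apply/eqP => E; move: satu; rewrite E => /andP[_ /eqP /= uE].
  by have := leq_trans vbk vkw; rewrite -ujE uE ltnn.
have [j' [k' [us' [can' sat' comp']]]] := IH us0.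
have jE : j' = j.
  apply/val_inj/eqP; rewrite eqn_leq leqNgt [X in _ && X]leqNgt.
  have [agr _ _ _] := can'; apply/andP; split; apply/negP => lt.
    by have := leq_trans vbk vkw; rewrite -ujE (agr _ lt) ltnn.
  by have := canonical_lt can'; rewrite (uagr _ lt) ltnn.
rewrite {j'}jE in can' sat' comp'; have [_ jk' /andP[ujk' uk'w] kmin'] := can'.
have k'k : k' <= k by apply: kmin'; rewrite // ujE ukE vbk.
have uk'E : u k' = v k' by apply: other; [rewrite eq_sym ltn_neq|rewrite ltn_neq // (leq_ltn_trans k'k)].
have kk' : k <= k' by apply: kmin; rewrite // -uk'E uk'w andbT (ltn_trans vjb) // -ujE.
have {k'k kk'} kE : k' = k by apply/val_inj/eqP; rewrite eqn_leq k'k.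
rewrite {k' jk' ujk' uk'w kmin' uk'E}kE in can' sat' comp'.
set x := perm_comp v (tperm j k); set z := perm_comp u (tperm j k) in sat' comp'.
have := sat'; rewrite saturated_chain_cons => /andP[uz satz].
have vx : bruhat_step v x by apply: up_bruhat_step; rewrite /up jk.
have xz : bruhat_step x z.
  rewrite /z (tperm_3cycle _ njb nkb njk); apply: up_bruhat_step.
  by rewrite /up kb !perm_compE tpermR tpermD // eq_sym.
have [|cvx cxz] := bruhat_step2_cover vx xz.
  by case/bruhat_coverP: vu => _; case/bruhat_coverP: uz => _ -> ->.
exists j, k, (z :: us'); split; [by []|by rewrite !saturated_chain_cons cvx cxz|].
rewrite compatible_cons comp' -compatible_cons.
exact: compatible_diamond (bruhat_cover_step vu) (bruhat_cover_step uz) vx xz.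
Qed.

(** A first edge that does not involve [j] lies entirely to its right. By induction the tail then
    starts with an edge at [j]; a diamond move brings an edge at [j] to the front, which reduces to
    [canonical_start_first]. *)
Lemma canonical_start_exists v w us : us != [::] -> saturated_chain v us w ->
  canonical_start v w us.
Proof.
have [m] := ubnP (size us); elim: m us v => // m IH [//|u us] v /= usm _ sat.
have := sat; rewrite saturated_chain_cons => /andP[vu satu].
have vw := saturated_chain_bruhat sat; have uw := saturated_chain_bruhat satu.
have [a [b [upab uE]]] := bruhat_stepP _ _ (bruhat_cover_step vu).
have nvw : v != w.
  apply/eqP => E; have := saturated_chain_length sat.
  by rewrite E /=; lia.
have [j [k can]] := canonical_exists vw nvw; have [agr jk _ _] := can.
have [ab vab] := andP upab.
have uaE : u a = v b by rewrite uE perm_compE tpermL.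
have ubE : u b = v a by rewrite uE perm_compE tpermR.
have other i : i != a -> i != b -> u i = v i.
  by move=> ia ib; rewrite uE perm_compE tpermD // eq_sym.
have agru : agree v u j by apply: bruhat_agree agr => //; apply/bruhat_step1/bruhat_cover_step.
have ja : j <= a.
  by rewrite leqNgt; apply/negP => /agru E; move: vab; rewrite E uaE ltnn.
have [E|nja] := eqVneq j a.
  rewrite E in can; rewrite uE in sat *; apply: canonical_start_first can upab sat _.
  by move=> us0; rewrite -uE; apply: IH.
have {}ja : j < a by rewrite ltn_neqAle -ord_eqE nja.
have njb := ltn_neq (ltn_trans ja ab); have nab := ltn_neq ab.
have ujE : u j = v j by rewrite other.
have us0 : us != [::].
  apply/eqP => E; move: satu; rewrite E => /andP[_ /eqP /= uwE].
  by have := canonical_lt can; rewrite -ujE uwE ltnn.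
have [j' [c [us' [can' sat' comp']]]] := IH us u usm us0 satu.
have jE : j' = j.
  apply/val_inj/eqP; rewrite eqn_leq leqNgt [X in _ && X]leqNgt.
  have [agr' _ _ _] := can'; apply/andP; split; apply/negP => lt.
    by have := canonical_lt can; rewrite -ujE (agr' _ lt) ltnn.
  by have := canonical_lt can'; rewrite -agru // agr // ltnn.
rewrite {j'}jE in can' sat' comp'; have [_ jc /andP[ujc _] _] := can'.
rewrite ujE in ujc.
set z := perm_comp u (tperm j c) in sat' comp'.
have := sat'; rewrite saturated_chain_cons => /andP[uz satz].
have njc := ltn_neq jc.
(* The other middle of the diamond from [v] to [z]. The choice of [d] is [c] if the two edges are
   disjoint, [a] if [c = b], and [a] or [b] if [c = a], according to whether [v j < v a]. *)
have [d [upd xz]] : exists d, up v j d /\ bruhat_step (perm_comp v (tperm j d)) z.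
  have nbj : b != j by rewrite eq_sym.
  have naj : a != j by rewrite eq_sym.
  have nba : b != a by rewrite eq_sym.
  have [ca|nca] := eqVneq c a.
    rewrite ca uaE in ujc; rewrite /z ca uE [tperm j a]tpermC (tperm_3cycle _ nab njb naj).
    have [vja|vaj] := ltnP (v j) (v a).
      exists a; split; first by rewrite /up ja.
      rewrite [tperm j a]tpermC; apply: up_bruhat_step.
      by rewrite /up (ltn_trans ja ab) !perm_compE tpermR tpermD.
    exists b; split; first by rewrite /up (ltn_trans ja ab).
    rewrite [tperm a j]tpermC (tperm_3cycle _ nja nba njb) [tperm b a]tpermC; apply: up_bruhat_step.
    by rewrite /up ab !perm_compE tpermR tpermD // ltn_neqAle vaj perm_neq.
  have [cb|ncb] := eqVneq c b.
    rewrite cb ubE in ujc; exists a; split; first by rewrite /up ja.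
    rewrite /z cb uE [tperm a b]tpermC [tperm j b]tpermC (tperm_3cycle _ nba nja nbj) [tperm b j]tpermC.
    rewrite (tperm_3cycle _ njb nab nja); apply: up_bruhat_step.
    by rewrite /up ab !perm_compE tpermR tpermD // (ltn_trans ujc).
  exists c; rewrite other // in ujc; split; first by rewrite /up jc.
  rewrite /z uE (tperm_disjoint _ nja njb nca ncb); apply: up_bruhat_step.
  by rewrite /up ab !perm_compE !tpermD // eq_sym.
have vx := up_bruhat_step upd.
have [|cvx cxz] := bruhat_step2_cover vx xz.
  by case/bruhat_coverP: vu => _; case/bruhat_coverP: uz => _ -> ->.
have satx : saturated_chain v (perm_comp v (tperm j d) :: z :: us') w.
  by rewrite !saturated_chain_cons cvx cxz.
have [|j1 [k1 [us1 [can1 sat1 comp1]]]] := canonical_start_first can upd satx.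
  have [szE] := saturated_chain_size satx sat.
  move=> _; apply: IH; [by rewrite /= szE|by []|].
  by move: satx; rewrite saturated_chain_cons => /andP[].
exists j1, k1, us1; split; [by []|by []|]; rewrite compatible_cons comp' -compatible_cons -comp1.
exact: compatible_diamond (bruhat_cover_step vu) (bruhat_cover_step uz) vx xz.
Qed.

(** Both chains can be made to start with the same canonical atom; removing it leaves two shorter
    chains with common endpoints. *)
Lemma compatible_chains v w us us' : saturated_chain v us w -> saturated_chain v us' w ->
  compatible v us = compatible v us'.
Proof.
have [m] := ubnP (size us); elim: m us us' v => // m IH us us' v usm sat sat'.
have szE := saturated_chain_size sat sat'.
have [E|us0] := eqVneq us [::].
  by move: szE; rewrite E /= => /esym/size0nil ->.
have us'0 : us' != [::] by rewrite -size_eq0 -szE size_eq0.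
have [j [k [r [can satr ->]]]] := canonical_start_exists us0 sat.
have [j' [k' [r' [can' satr' ->]]]] := canonical_start_exists us'0 sat'.
have [jE kE] := canonical_unique can can'.
clear can'; rewrite -{j'}jE -{k'}kE in satr' *; rewrite !compatible_cons; congr (_ && _).
have szr := saturated_chain_size sat satr; rewrite szr in usm.
move: satr satr'; rewrite !saturated_chain_cons => /andP[_ satr] /andP[_ satr'].
exact: IH satr satr'.
Qed.

End Colouring.
End Chains.

(** * Components and the weight cone *)

Section Graph.
Variable n : nat.
Implicit Types (u v w x y z : 'S_n) (a b c i j k : 'I_n) (us : seq 'S_n).

(** A reflection with empty rectangle is a cover; otherwise a position in between splits it into
    three steps of smaller length difference. *)
Lemma bruhat_step_saturated x y : bruhat_step x y -> exists us, saturated_chain x us y.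
Proof.
have [d] := ubnP (coxeter_length y - coxeter_length x).
elim: d x y => // d IH x y xyd xy.
have [a [b [upx yE]]] := bruhat_stepP _ _ xy; have [ab xab] := andP upx.
have [/existsP[c bc]|nb] := boolP [exists c : 'I_n, between x a b c]; last first.
  exists [:: y]; rewrite saturated_chain_cons /saturated_chain /= eqxx !andbT.
  apply/bruhat_coverP; split; first exact: xy.
  rewrite yE !coxeter_lengthE; case: (inversions_up_between upx) => _; apply=> c.
  by move: nb; rewrite negb_exists => /forallP.
have [/andP[ac cb] /andP[xac xcb]] := andP bc.
have [s1 s2 s3] := between_steps upx bc; rewrite -yE in s3.
have := bruhat_step_length s1; have := bruhat_step_length s2; have := bruhat_step_length s3.
move=> l3 l2 l1.
have [|us1 c1] := IH _ _ _ s1; first by clear -xyd l1 l2 l3; lia.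
have [|us2 c2] := IH _ _ _ s2; first by clear -xyd l1 l2 l3; lia.
have [|us3 c3] := IH _ _ _ s3; first by clear -xyd l1 l2 l3; lia.
by exists (us1 ++ us2 ++ us3); do 2?[apply: saturated_chain_cat; [eassumption|]].
Qed.

Lemma saturated_chain_exists v w : bruhat v w -> exists us, saturated_chain v us w.
Proof.
move: v; apply: bruhat_ind => [|x y xy _ [us2 yus2]].
  by exists [::]; rewrite /saturated_chain /=.
have [us1 xus1] := bruhat_step_saturated xy; exists (us1 ++ us2).
exact: saturated_chain_cat yus2.
Qed.

Lemma chain_graph_cons v u us a b : chain_graph v (u :: us) a b =
  (a != b) && (u == perm_comp v (tperm a b)) || chain_graph u us a b.
Proof. by rewrite /chain_graph /= andb_orr. Qed.

Lemma compatible_graph (T : eqType) (f : 'I_n -> T) v us w : saturated_chain v us w ->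
  (forall a b, chain_graph v us a b -> f a = f b) -> compatible f v us.
Proof.
elim: us v => [//|u us IH] v; rewrite saturated_chain_cons => /andP[vu satu] fG.
have [a [b [upab uE]]] := bruhat_stepP _ _ (bruhat_cover_step vu).
rewrite compatible_cons (IH u satu) => [|c d cd]; last first.
  by apply: fG; rewrite chain_graph_cons cd orbT.
rewrite andbT uE colour_tperm; apply/eqP/fG; rewrite chain_graph_cons -uE eqxx andbT.
by case/andP: upab => /ltn_neq ->.
Qed.

Lemma chain_graph_sym v us : symmetric (chain_graph v us).
Proof.
by move=> a b; rewrite /chain_graph eq_sym; congr (_ && _); apply: eq_has => p; rewrite tpermC.
Qed.

(** Colour each position by its component in the given chain. That chain is compatible, hence so is
    any chain passing through v t_(a,b), and therefore [a] and [b] have the same colour. *)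
Lemma reflection_connected v us w a b : saturated_chain v us w -> up v a b ->
  bruhat (perm_comp v (tperm a b)) w -> connect (chain_graph v us) a b.
Proof.
move=> sat upab vabw; have csym := sym_connect_sym (@chain_graph_sym v us).
pose f c := [set d | connect (chain_graph v us) c d].
have fG c d : chain_graph v us c d -> f c = f d.
  by move=> cd; apply/setP => e; rewrite !inE (same_connect csym (connect1 cd)).
have [us1 sat1] := bruhat_step_saturated (up_bruhat_step upab).
have [us2 sat2] := saturated_chain_exists vabw.
have := compatible_graph sat fG.
rewrite (compatible_chains f sat (saturated_chain_cat sat1 sat2)) /compatible all_cat.
case/andP => cus1 _; have : colour f (last v us1) == colour f v.
  by case/lastP: us1 cus1 {sat1} => [|s x]; rewrite ?last_rcons // all_rcons => /andP[].
case/andP: sat1 => _ /eqP ->; rewrite colour_tperm => /eqP/setP/(_ b).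
by rewrite !inE connect0.
Qed.

Definition tperm_product (es : seq ('I_n * 'I_n)) : 'S_n :=
  foldr (fun e p => perm_comp (tperm e.1 e.2) p) 1%g es.

(** One pair is listed per step, so that the list has the length of the chain even if an edge
    recurs. The graph is undirected, whence the two alternatives for the orientation. *)
Lemma chain_edges v us w : saturated_chain v us w ->
  exists es, [/\ size es = size us, w = perm_comp v (tperm_product es),
    forall e, e \in es -> chain_graph v us e.1 e.2 &
    forall a b, chain_graph v us a b -> (a, b) \in es \/ (b, a) \in es].
Proof.
elim: us v => [|u us IH] v.
  case/andP => _ /eqP /= <-; exists [::]; split=> // [|a b]; first by rewrite /perm_comp mul1g.
  by rewrite /chain_graph /= andbF.
rewrite saturated_chain_cons => /andP[vu satu].
have [es [sz wE esG Ges]] := IH u satu.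
have [a [b [upab uE]]] := bruhat_stepP _ _ (bruhat_cover_step vu).
have [/ltn_neq ab _] := andP upab.
exists ((a, b) :: es); split => [|||c d].
- by rewrite /= sz.
- by rewrite wE uE /= perm_compA.
- move=> e; rewrite inE chain_graph_cons => /orP[/eqP ->|/esG ->]; last by rewrite orbT.
  by rewrite ab -uE eqxx.
rewrite chain_graph_cons => /orP[/andP[cd /eqP]|/Ges[cd|cd]]; last 2 first.
- by left; rewrite inE cd orbT.
- by right; rewrite inE cd orbT.
rewrite uE /perm_comp => /mulIg E; rewrite !inE !xpair_eqE.
have := congr1 (fun s : 'S_n => s a) E; rewrite /= tpermL.
case: tpermP => [-> ->|-> ->|_ _ ba]; [by left; rewrite !eqxx|by right; rewrite !eqxx|].
by rewrite ba eqxx in ab.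
Qed.

End Graph.

Import GRing.Theory Num.Theory.

(** * The span of the edge vectors *)

Section Cone.
Variables (R : realType) (n : nat).
Implicit Types (u v w : 'S_n) (a b i j k : 'I_n) (us : seq 'S_n).
Local Open Scope ring_scope.

Lemma cone_dim_le (S : set 'rV[R]_n) (V : {vspace 'rV[R]_n}) :
  (forall x, S x -> x \in V) -> (cone_dim S <= \dim V)%N.
Proof.
move=> SV; apply/bigmax_leqP => k /asboolP[X [freeX XS]].
move: (freeX); rewrite /free size_tuple => /eqP <-; apply/dimvS/span_subvP => x /XS.
exact: SV.
Qed.

Definition edge_vector v (e : 'I_n * 'I_n) : 'rV[R]_n := 'e_(v e.1) - 'e_(v e.2).

Lemma connect_edge_vector v (V : {vspace 'rV[R]_n}) (e : rel 'I_n) :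
  (forall a b, e a b -> edge_vector v (a, b) \in V) ->
  forall a b, connect e a b -> edge_vector v (a, b) \in V.
Proof.
move=> eV a b /connectP[p]; elim: p a => [|c p IH] a /=.
  by move=> _ ->; rewrite /edge_vector subrr mem0v.
move=> /andP[ac cp] /(IH _ cp) cbV.
have -> : edge_vector v (a, b) = edge_vector v (a, c) + edge_vector v (c, b).
  by rewrite /edge_vector addrA subrK.
exact: memvD (eV _ _ ac) cbV.
Qed.

(** A generator of the cone is the edge vector of a pair [(j, k)] with v t_(j,k) below [w]. Such
    positions are connected in the chain graph, and edge vectors telescope along a path. *)
Lemma weight_cone_sub v us w es : saturated_chain v us w ->
  (forall a b, chain_graph v us a b -> (a, b) \in es \/ (b, a) \in es) ->
  forall x, weight_cone R v w x -> x \in <<[seq edge_vector v e | e <- es]>>%VS.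
Proof.
move=> sat Ges x [c _ ->]; apply: memv_suml => -[i j]; rewrite !inE /= => /andP[/andP[vji jvi]].
move=> tw; apply: memvZ; set k := (v^-1)%g i in jvi.
have iE : i = v k by rewrite permKV.
rewrite iE; apply: (@connect_edge_vector v _ (chain_graph v us)) => [a b|].
  case/Ges => [ab|ba]; first by apply/memv_span/map_f.
  rewrite -memvN opprB; apply/memv_span/mapP.
  by exists (b, a).
apply: reflection_connected sat _ _; first by rewrite /up jvi -iE.
suff -> : perm_comp v (tperm j k) = perm_comp (tperm (v j) i) v by [].
by rewrite /perm_comp [LHS]conjgC tpermJ -iE.
Qed.

(** This is the sum of the vectors [f i] e_(v i); like the edge vectors, it has its coordinates
    indexed by values. *)
Definition function_row v (f : 'I_n -> R) : 'rV[R]_n := \row_p f ((v^-1)%g p).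

Lemma eq_function_row v f g : f =1 g -> function_row v f = function_row v g.
Proof. by move=> fg; apply/rowP => p; rewrite !mxE fg. Qed.

Lemma function_row_tperm v (f : 'I_n -> R) a b :
  function_row v (f \o tperm a b) = function_row v f - (f a - f b) *: edge_vector v (a, b).
Proof.
apply/rowP => p; rewrite !mxE /= ?eqxx /=.
have -> : (p == v a) = ((v^-1)%g p == a) by rewrite -(inj_eq (@perm_inj _ v)) permKV.
have -> : (p == v b) = ((v^-1)%g p == b) by rewrite -(inj_eq (@perm_inj _ v)) permKV.
move: ((v^-1)%g p) => q; case: tpermP => [->|->|/eqP/negPf -> /eqP/negPf ->].
- by rewrite eqxx; case: eqVneq => [->|_]; rewrite ?subrr ?mulr0 ?subr0 // mulr1 subKr.
- rewrite eqxx; case: eqVneq => [->|_]; first by rewrite !subrr mulr0 subr0.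
  by rewrite sub0r mulrN1 opprK addrC subrK.
- by rewrite subrr mulr0 subr0.
Qed.

(* Carter's lemma: telescoping f, f t_1, f t_1 t_2, .. turns the invariance of f into a linear
   relation between the edge vectors. *)
Lemma free_edges_fixed v es (f : 'I_n -> R) :
  free [seq edge_vector v e | e <- es] ->
  (forall i, f (tperm_product es i) = f i) ->
  forall e, e \in es -> f e.1 = f e.2.
Proof.
have span g fs : function_row v g - function_row v (g \o tperm_product fs)
    \in <<[seq edge_vector v e | e <- fs]>>%VS.
  elim: fs g => [|[a b] fs IH] g /=.
    by rewrite (@eq_function_row v _ g) ?subrr ?mem0v // => i; rewrite /= perm1.
  rewrite (@eq_function_row v (g \o _) ((g \o tperm a b) \o tperm_product fs)); last first.
    by move=> i; rewrite /= perm_compE.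
  have := IH (g \o tperm a b); rewrite function_row_tperm => h.
  rewrite span_cons -[X in X - _](subrK ((g a - g b) *: edge_vector v (a, b))).
  by rewrite addrAC addrC; apply: memv_add => //; rewrite memvZ ?memv_line.
elim: es f => [//|[a b] es IH] f /=; rewrite free_cons => /andP[ynot fr] fE.
(* Were [f a] and [f b] different, the relation for the remaining edges, applied to
   [f \o tperm a b], would put the first edge vector in the span of the others. *)
have fab : f a = f b.
  apply/eqP; rewrite -subr_eq0; apply: contraNT ynot => fab.
  have := span (f \o tperm a b) es; rewrite function_row_tperm.
  rewrite (@eq_function_row v (_ \o tperm_product es) f) => [|i]; last first.
    by rewrite -[RHS]fE /= perm_compE.
  by rewrite addrAC subrr sub0r memvN rpredZeq (negPf fab).
have fE' i : f (tperm_product es i) = f i.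
  rewrite -[RHS]fE /= perm_compE.
  by case: tpermP => [->|->|].
by move=> e; rewrite inE => /orP[/eqP -> //|]; exact: IH.
Qed.

End Cone.

(** * Polynomial curves *)

Section Curves.
Variables (K : numFieldType) (n : nat).
Local Open Scope ring_scope.

Definition polycurve (h : K -> K) := exists p : {poly K}, forall c, h c = p.[c].

Lemma polycurve_const k : polycurve (fun=> k).
Proof. by exists k%:P => c; rewrite hornerC. Qed.

Lemma polycurve_id : polycurve id.
Proof. by exists 'X => c; rewrite hornerX. Qed.

Lemma polycurveD h k : polycurve h -> polycurve k -> polycurve (fun c => h c + k c).
Proof. by move=> [p hp] [q kq]; exists (p + q) => c; rewrite hornerD hp kq. Qed.

Lemma polycurveM h k : polycurve h -> polycurve k -> polycurve (fun c => h c * k c).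
Proof. by move=> [p hp] [q kq]; exists (p * q) => c; rewrite hornerM hp kq. Qed.

Lemma polycurve_sum (I : Type) (r : seq I) (F : I -> K -> K) :
  (forall i, polycurve (F i)) -> polycurve (fun c => \sum_(i <- r) F i c).
Proof.
move=> pF; elim: r => [|i r [q qE]]; first by exists 0 => c; rewrite big_nil horner0.
by have [p pE] := pF i; exists (p + q) => c; rewrite big_cons hornerD -pE -qE.
Qed.

Lemma polycurve_neq0 h c0 : polycurve h -> h c0 != 0 -> exists2 p : {poly K}, p != 0 & forall c, h c = p.[c].
Proof.
move=> [p hp] h0; exists p => //; apply: contraNneq h0 => p0.
by rewrite hp p0 horner0.
Qed.

(** In characteristic zero the natural numbers below [size p] are distinct elements, too many to be
    all roots. *)
Lemma poly_nonroot (p : {poly K}) : p != 0 -> exists c, p.[c] != 0.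
Proof.
move=> p0; apply: contrapT => nop.
have allr : all (root p) [seq i%:R | i <- iota 0 (size p)].
  by apply/allP => c _; apply/rootP/eqP/negPn/negP => pc; apply: nop; exists c.
have := max_poly_roots p0 allr; rewrite map_inj_uniq ?iota_uniq => [|i j /eqP]; last first.
  by rewrite eqr_nat => /eqP.
by rewrite size_map size_iota ltnn => /(_ isT).
Qed.

(** The product of finitely many nonzero polynomials is nonzero. This is how several open conditions
    are met at once along a curve. *)
Lemma polycurves_nonzero (hs : seq (K -> K)) :
  (forall h, List.In h hs -> polycurve h /\ exists c, h c != 0) ->
  exists c, forall h, List.In h hs -> h c != 0.
Proof.
move=> hsP; suff [p p0 pP] : exists2 p : {poly K}, p != 0 &
    forall c, p.[c] != 0 -> forall h, List.In h hs -> h c != 0.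
  by have [c pc] := poly_nonroot p0; exists c; apply: pP.
elim: hs hsP => [|h hs IH] hsP; first by exists 1; rewrite ?oner_neq0.
have [|p p0 pP] := IH; first by move=> k ks; apply: hsP; right.
have [hc [c0 hc0]] := hsP h (or_introl erefl).
have [q q0 qE] := polycurve_neq0 hc hc0; exists (q * p); first by rewrite mulf_neq0.
move=> c; rewrite hornerM mulf_eq0 negb_or => /andP[qc pc] k [<-|]; first by rewrite qE.
exact: pP.
Qed.

Lemma polyfun_curve (f : 'M[K]_n -> K) (g : K -> 'M[K]_n) : polyfun f ->
  (forall i j, polycurve (fun c => g c i j)) -> polycurve (fun c => f (g c)).
Proof.
move=> pf pg; elim: pf => [k|i j|f1 f2 _ p1 _ p2|f1 f2 _ p1 _ p2].
- exact: polycurve_const.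
- exact: pg.
- exact: polycurveD.
- exact: polycurveM.
Qed.

Lemma polycurve_mulmx m p q (g : K -> 'M[K]_(m, p)) (h : K -> 'M[K]_(p, q)) :
  (forall i j, polycurve (fun c => g c i j)) -> (forall i j, polycurve (fun c => h c i j)) ->
  forall i j, polycurve (fun c => (g c *m h c) i j).
Proof.
move=> pg ph i j; have := @polycurve_sum _ (index_enum 'I_p) (fun k c => g c i k * h c k j).
case=> [k|r rE]; first exact: polycurveM.
by exists r => c; rewrite mxE -rE.
Qed.

Lemma polycurve_line m p (A B : 'M[K]_(m, p)) i j : polycurve (fun c => (A + c *: B) i j).
Proof.
exists ((A i j)%:P + (B i j)%:P * 'X) => c.
by rewrite !mxE hornerD hornerM !hornerC hornerX mulrC.
Qed.

Lemma eq_polyfun (f g : 'M[K]_n -> K) : f =1 g -> polyfun f -> polyfun g.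
Proof. by move=> /funext ->. Qed.

Lemma polyfun_sum (I : Type) (r : seq I) (F : I -> 'M[K]_n -> K) :
  (forall i, polyfun (F i)) -> polyfun (fun A => \sum_(i <- r) F i A).
Proof.
move=> pF; elim: r => [|i r IH].
  by apply: eq_polyfun (PolyConst _ 0) => A; rewrite big_nil.
by apply: eq_polyfun (PolyAdd (pF i) IH) => A; rewrite big_cons.
Qed.

Lemma polyfun_prod (I : Type) (r : seq I) (F : I -> 'M[K]_n -> K) :
  (forall i, polyfun (F i)) -> polyfun (fun A => \prod_(i <- r) F i A).
Proof.
move=> pF; elim: r => [|i r IH].
  by apply: eq_polyfun (PolyConst _ 1) => A; rewrite big_nil.
by apply: eq_polyfun (PolyMul (pF i) IH) => A; rewrite big_cons.
Qed.

Definition polymap m p (F : 'M[K]_n -> 'M[K]_(m, p)) := forall i j, polyfun (fun A => F A i j).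

Lemma polymap_id : polymap (fun A => A).
Proof. by move=> i j; exact: PolyCoord. Qed.

Lemma polymap_const m p (B : 'M[K]_(m, p)) : polymap (fun=> B).
Proof. by move=> i j; exact: PolyConst. Qed.

Lemma polymap_mul m p q (F : 'M[K]_n -> 'M[K]_(m, p)) (G : 'M[K]_n -> 'M[K]_(p, q)) :
  polymap F -> polymap G -> polymap (fun A => F A *m G A).
Proof.
move=> pF pG i j; have := @polyfun_sum _ (index_enum 'I_p) (fun k A => F A i k * G A k j).
move=> h; apply: eq_polyfun (h _) => [A|k]; first by rewrite mxE.
exact: PolyMul.
Qed.

Lemma polyfun_det m (F : 'M[K]_n -> 'M[K]_m) : polymap F -> polyfun (fun A => \det (F A)).
Proof.
move=> pF; apply: polyfun_sum => s; apply: (PolyMul (PolyConst _ _)).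
by apply: polyfun_prod => i.
Qed.

Lemma polymap_adj m (F : 'M[K]_n -> 'M[K]_m) : polymap F -> polymap (fun A => \adj (F A)).
Proof.
move=> pF i j.
apply: (@eq_polyfun (fun A => (-1) ^+ (j + i) * \det (row' j (col' i (F A))))).
  by move=> A; rewrite mxE.
apply: (PolyMul (PolyConst _ _)); apply: polyfun_det => k l.
by apply: eq_polyfun (pF (lift j k) (lift i l)) => A; rewrite !mxE.
Qed.

Lemma polyfun_comp (f : 'M[K]_n -> K) (F : 'M[K]_n -> 'M[K]_n) :
  polyfun f -> polymap F -> polyfun (fun A => f (F A)).
Proof.
move=> pf pF; elim: pf => [k|i j|f1 f2 _ p1 _ p2|f1 f2 _ p1 _ p2].
- exact: PolyConst.
- exact: pF.
- exact: PolyAdd.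
- exact: PolyMul.
Qed.

End Curves.

(** * Triangular matrices and a division-free UL factorization *)

Section Triangular.
Variables (K : fieldType) (n : nat).
Local Open Scope ring_scope.
Implicit Types (A B : 'M[K]_n).

Lemma is_trig_mulmx A B : is_trig_mx A -> is_trig_mx B -> is_trig_mx (A *m B).
Proof.
move=> /is_trig_mxP tA /is_trig_mxP tB; apply/is_trig_mxP => i j ij.
rewrite mxE big1 // => k _; have [ik|ki] := ltnP i k; first by rewrite tA ?mul0r.
by rewrite tB ?mulr0 // (leq_ltn_trans ki).
Qed.

Lemma is_trig_invmx A : A \in unitmx -> is_trig_mx A -> is_trig_mx (invmx A).
Proof.
move=> uA tA; have /is_trig_mxP tA' := tA.
have diag i : A i i != 0.
  by move: uA; rewrite unitmxE unitfE det_trig // => /prodf_neq0; apply.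
apply/is_trig_mxP => i j; have [m] := ubnP i; elim: m i => // m IH i im ij.
have : (A *m invmx A) i j = 0 by rewrite mulmxV // !mxE -val_eqE ltn_eqF.
rewrite mxE (bigD1 i) //= big1 => [|k ki].
  by rewrite addr0 => /eqP; rewrite mulf_eq0 (negPf (diag i)) => /eqP.
have [ik|ik] := ltnP i k; first by rewrite tA' ?mul0r.
have {}ki : (k < i)%N by rewrite ltn_neqAle ik andbT.
by rewrite (IH k (leq_trans ki im) (ltn_trans ki ij)) mulr0.
Qed.

(** The lower right block is padded with the identity: the size stays [n] for every [i], and the
    determinant is the trailing principal minor. *)
Definition trailing A (i : 'I_n) : 'M[K]_n :=
  \matrix_(a, b) if (i <= a)%N && (i <= b)%N then A a b else (a == b)%:R.

(* Row i of ul_factor A is row i of the adjugate of the trailing block of A starting at (i,i);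
   by Cramer's rule it clears the entries of row i of A to the right of the diagonal. *)
Definition ul_factor A : 'M[K]_n :=
  \matrix_(i, j) if (i <= j)%N then \adj (trailing A i) i j else 0.

Lemma ul_factor_trig A : is_trig_mx (ul_factor A)^T.
Proof. by apply/is_trig_mxP => i j ij; rewrite !mxE leqNgt ij. Qed.

Lemma ul_factor_mul A (i k : 'I_n) : (i <= k)%N ->
  (ul_factor A *m A) i k = \det (trailing A i) *+ (i == k).
Proof.
move=> ik; have := congr1 (fun B : 'M_n => B i k) (mul_adj_mx (trailing A i)).
rewrite /= [RHS]mxE => <-; rewrite !mxE; apply: eq_bigr => j _.
rewrite [ul_factor _ _ _]mxE [trailing _ _ j k]mxE ik andbT.
have [ij //|ji] := leqP i j; rewrite mul0r.
by rewrite -val_eqE ltn_eqF ?mulr0 // (leq_trans ji).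
Qed.

Lemma ul_product_trig A : is_trig_mx (ul_factor A *m A).
Proof. by apply/is_trig_mxP => i j ij; rewrite ul_factor_mul 1?ltnW // -val_eqE ltn_eqF. Qed.

Lemma det_ul_product A : \det (ul_factor A *m A) = \prod_i \det (trailing A i).
Proof.
by rewrite det_trig ?ul_product_trig //; apply: eq_bigr => i _; rewrite ul_factor_mul // eqxx.
Qed.

Lemma trailing1 i : trailing 1%:M i = 1%:M.
Proof. by apply/matrixP => a b; rewrite !mxE if_same. Qed.

End Triangular.

(** * Richardson pieces of the flag variety *)

Section Flags.
Variables (K : numFieldType) (n : nat).
Local Open Scope ring_scope.
Local Open Scope classical_set_scope.
Local Notation GLval := Defs.GLval.
Implicit Types (g h b : GL K n) (u v w : 'S_n).

Lemma GLval_inj g h : GLval g = GLval h -> g = h.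
Proof. exact: val_inj. Qed.

Definition invGL g : GL K n := MkGL (etrans (unitmx_inv (GLval g)) (GLvalP g)).

Lemma mulGLA g h k : mulGL g (mulGL h k) = mulGL (mulGL g h) k.
Proof. by apply: GLval_inj; rewrite /= mulmxA. Qed.

Lemma mulGLK g h : mulGL (mulGL g h) (invGL h) = g.
Proof. by apply: GLval_inj; rewrite /= mulmxK // GLvalP. Qed.

Lemma mulVGLK g h : mulGL (invGL g) (mulGL g h) = h.
Proof. by apply: GLval_inj; rewrite /= mulKmx // GLvalP. Qed.

Lemma borelM b c : borel b -> borel c -> borel (mulGL b c).
Proof. by rewrite /borel /= => tb tc; rewrite trmx_mul is_trig_mulmx. Qed.

Lemma borelV b : borel b -> borel (invGL b).
Proof. by rewrite /borel /= => tb; rewrite trmx_inv is_trig_invmx // unitmx_tr GLvalP. Qed.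

Lemma to_flag_borel g b : borel b -> to_flag (mulGL g b) = to_flag g.
Proof.
move=> bb; apply/eqmodP/asboolP/seteqP; split=> _ [c bc <-].
  by exists (mulGL b c); [exact: borelM|rewrite mulGLA].
exists (mulGL (invGL b) c); first by apply: borelM => //; exact: borelV.
by rewrite mulGLA mulGLK.
Qed.

Lemma to_flag_eq g h : to_flag g = to_flag h -> exists2 b, borel b & h = mulGL g b.
Proof.
move/eqmodP/asboolP => E; have [b bb <-] : borel_coset g h; last by exists b.
rewrite E; exists (MkGL (unitmx1 K n)); first by rewrite /borel /= trmx1 scalar_mx_is_trig.
by apply: GLval_inj; rewrite /= mulmx1.
Qed.

Lemma openE_flag (U : set (flag K n)) : open U <-> zariski_open [set g | U (to_flag g)].
Proof.
by [].
Qed.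

Lemma closed_flag_separate (F : set (flag K n)) g : closed F -> ~ F (to_flag g) ->
  exists f, [/\ polyfun f, f (GLval g) != 0 & forall h, F (to_flag h) -> f (GLval h) = 0].
Proof.
rewrite -openC openE_flag => -[Fs Fsp FsE] Fg.
have FE h : F (to_flag h) <-> forall f, Fs f -> f (GLval h) = 0.
  have := congr1 (fun S : set (GL K n) => S h) FsE; rewrite /setC /= => <-.
  by split=> [? //|/contrapT].
have /existsNP[f /not_implyP[Ff fg]] : ~ forall f, Fs f -> f (GLval g) = 0.
  by move=> h; apply: Fg; apply/FE.
by exists f; split=> [||h /FE]; [exact: Fsp|exact/eqP|exact].
Qed.

Lemma closed_flag (Fs : set ('M[K]_n -> K)) (Z : set (flag K n)) :
  (forall f, Fs f -> polyfun f) ->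
  (forall g, Z (to_flag g) <-> forall f, Fs f -> f (GLval g) = 0) -> closed Z.
Proof.
move=> Fsp ZE; rewrite -openC openE_flag; exists Fs => //.
apply/seteqP; split=> g /=; rewrite /setC /=.
  by move=> /contrapT /ZE.
by move=> /ZE Zg; exact.
Qed.

Definition bruhat_double u g := exists b c,
  [/\ borel b, borel c & g = mulGL (mulGL b (permGL K u)) c].

(** [A *m perm_mx v] is A P_v^-1 for the permutation matrix P_v of [v]. Where this product of
    trailing minors does not vanish, A lies in B B_- v. *)
Definition ul_det v (A : 'M[K]_n) : K := \prod_i \det (trailing (A *m perm_mx v) i).

(** Where [ul_det v A] is nonzero, the result lies both in B A and in B_- v: the double coset of A
    is kept while the flag moves into the opposite cell of [v]. Adjugates in place of inverses make
    the map polynomial. *)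
Definition ul_project v (A : 'M[K]_n) : 'M[K]_n := ul_factor (A *m perm_mx v) *m A.

Lemma polymap_trailing (F : 'M[K]_n -> 'M[K]_n) i :
  polymap F -> polymap (fun A => trailing (F A) i).
Proof.
move=> pF a b; have [E|E] := boolP ((i <= a)%N && (i <= b)%N).
  by apply: eq_polyfun (pF a b) => A; rewrite mxE E.
by apply: eq_polyfun (PolyConst _ (a == b)%:R) => A; rewrite mxE (negPf E).
Qed.

Lemma polyfun_ul_det v : polyfun (ul_det v).
Proof.
apply: polyfun_prod => i; apply/polyfun_det/polymap_trailing.
exact: (polymap_mul (@polymap_id K n) (@polymap_const K n _ _ (perm_mx v))).
Qed.

Lemma polymap_ul_project v : polymap (ul_project v).
Proof.
have pF := polymap_mul (@polymap_id K n) (@polymap_const K n _ _ (perm_mx v)).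
apply: (fun pB => polymap_mul pB (@polymap_id K n)) => i j.
have [ij|ji] := leqP i j.
  by apply: eq_polyfun (polymap_adj (polymap_trailing i pF) i j) => A; rewrite [RHS]mxE ij.
by apply: eq_polyfun (PolyConst _ 0) => A; rewrite [RHS]mxE leqNgt ji.
Qed.

Lemma permGL_mul_perm_mx v : GLval (permGL K v) *m perm_mx v = 1%:M.
Proof. by rewrite /= tr_perm_mx -perm_mxM mulVg perm_mx1. Qed.

Lemma ul_det_permGL v : ul_det v (GLval (permGL K v)) = 1.
Proof. by rewrite /ul_det permGL_mul_perm_mx big1 // => i _; rewrite trailing1 det1. Qed.

Lemma det_ul_project v A : \det (ul_project v A) * \det (perm_mx v) = ul_det v A.
Proof. by rewrite -det_mulmx -mulmxA det_ul_product. Qed.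

Lemma ul_project_unit v A : ul_det v A != 0 -> ul_project v A \in unitmx.
Proof. by rewrite -det_ul_project mulf_eq0 negb_or unitmxE unitfE => /andP[]. Qed.

Definition ul_projectGL v (A : 'M[K]_n) (A0 : ul_det v A != 0) := MkGL (ul_project_unit A0).

Lemma ul_project_borel v g (g0 : ul_det v (GLval g) != 0) :
  exists2 b, borel b & ul_projectGL g0 = mulGL b g.
Proof.
have u : ul_factor (GLval g *m perm_mx v) \in unitmx.
  by have := ul_project_unit g0; rewrite unitmx_mul => /andP[].
by exists (MkGL u); [exact: ul_factor_trig|exact: GLval_inj].
Qed.

Lemma ul_project_opp_borel v g (g0 : ul_det v (GLval g) != 0) :
  exists2 b, opp_borel b & ul_projectGL g0 = mulGL b (permGL K v).
Proof.
have u : ul_project v (GLval g) *m perm_mx v \in unitmx.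
  by rewrite unitmx_mul ul_project_unit ?unitmx_perm.
exists (MkGL u); first by rewrite /opp_borel /= -mulmxA ul_product_trig.
by apply: GLval_inj; rewrite /= -mulmxA tr_perm_mx -perm_mxM mulgV perm_mx1 mulmx1.
Qed.

(* Points of the open Richardson variety of v and u, as the images of an open subset of B x B
   under a polynomial map. *)
Definition richardson v u : set (flag K n) := [set x | exists g (g0 : ul_det v (GLval g) != 0),
  bruhat_double u g /\ x = to_flag (ul_projectGL g0)].

Lemma richardson_double v u x : richardson v u x ->
  exists2 g, bruhat_double u g & x = to_flag g.
Proof.
move=> [g [g0 [[b [c [bb bc gE]]] ->]]]; have [d bd dE] := ul_project_borel g0.
exists (ul_projectGL g0) => //; exists (mulGL d b), c; split=> //; first exact: borelM.
by rewrite dE gE !mulGLA.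
Qed.

Lemma richardson_cell v u : richardson v u `<=` schubert_cell K u.
Proof.
move=> _ /richardson_double[_ [b [c [bb bc ->]]] ->].
by exists b => //; rewrite [RHS]to_flag_borel.
Qed.

Lemma richardson_opp_cell v u : richardson v u `<=` opp_schubert_cell K v.
Proof.
move=> _ [g [g0 [_ ->]]]; have [b bb ->] := ul_project_opp_borel g0.
by exists b.
Qed.

Lemma richardson_refl v : richardson v v !=set0.
Proof.
have g0 : ul_det v (GLval (permGL K v)) != 0 by rewrite ul_det_permGL oner_neq0.
exists (to_flag (ul_projectGL g0)), (permGL K v), g0; split=> //.
have b1 : borel (MkGL (unitmx1 K n)) by rewrite /borel /= trmx1 scalar_mx_is_trig.
exists (MkGL (unitmx1 K n)), (MkGL (unitmx1 K n)); split=> //.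
by apply: GLval_inj; rewrite /= mul1mx mulmx1.
Qed.

Lemma richardson_in v u g f : polyfun f ->
  (forall h, richardson v u (to_flag h) -> f (GLval h) = 0) ->
  bruhat_double u g -> ul_det v (GLval g) != 0 -> f (ul_project v (GLval g)) = 0.
Proof. by move=> pf fR gd g0; apply: (fR (ul_projectGL g0)); exists g, g0. Qed.

Lemma trig_line (A B : 'M[K]_n) c : is_trig_mx A^T -> is_trig_mx B^T -> is_trig_mx (A + c *: (B - A))^T.
Proof.
move=> /is_trig_mxP tA /is_trig_mxP tB; apply/is_trig_mxP => i j ij.
by have := tA i j ij; have := tB i j ij; rewrite !mxE => -> ->; rewrite subrr mulr0 addr0.
Qed.

(** Suppose that neither closed set contains the piece, and take a point of the piece outside each.
    Lines between their left and right Borel factors give a polynomial curve, and a generic point of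
    it projects to a point of the piece outside both sets. *)
Lemma richardson_irreducible v u : richardson v u !=set0 -> irreducible_set (richardson v u).
Proof.
move=> ne; split=> // F1 F2 cF1 cF2 sub; apply: contrapT => /not_orP[].
move=> /existsNP[_ /not_implyP[[g1 [g10 [[b1 [c1 [bb1 bc1 g1E]]] ->]]] n1]].
move=> /existsNP[_ /not_implyP[[g2 [g20 [[b2 [c2 [bb2 bc2 g2E]]] ->]]] n2]].
have [f1 [pf1 f1n f1F]] := closed_flag_separate cF1 n1.
have [f2 [pf2 f2n f2F]] := closed_flag_separate cF2 n2.
pose lb c := GLval b1 + c *: (GLval b2 - GLval b1).
pose lc c := GLval c1 + c *: (GLval c2 - GLval c1).
pose gam c := lb c *m GLval (permGL K u) *m lc c.
have lb_poly i j : polycurve (fun c => lb c i j) by exact: polycurve_line.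
have lc_poly i j : polycurve (fun c => lc c i j) by exact: polycurve_line.
have gam_poly : forall i j, polycurve (fun c => gam c i j).
  apply: polycurve_mulmx => //; apply: polycurve_mulmx => // i j; exact: polycurve_const.
have gam0 : gam 0 = GLval g1 by rewrite /gam /lb /lc !scale0r !addr0 g1E.
have gam1 : gam 1 = GLval g2 by rewrite /gam /lb /lc !scale1r ![_ + (_ - _)]addrC !subrK g2E.
have detE (c : GL K n) : \det (GLval c) != 0 by rewrite -unitfE -unitmxE GLvalP.
(* The conditions say that both separating polynomials are nonzero, that the projection is defined,
   and that the two triangular factors stay invertible. Each holds at parameter 0 or 1. *)
have [|c cP] := @polycurves_nonzero K [:: fun c => f1 (ul_project v (gam c));
    fun c => f2 (ul_project v (gam c)); fun c => ul_det v (gam c);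
    fun c => \det (lb c); fun c => \det (lc c)].
  have pp f (pf : polyfun f) := polyfun_curve pf gam_poly.
  move=> _ /= [<-|[<-|[<-|[<-|[<-|//]]]]]; split.
  - exact: (pp _ (polyfun_comp pf1 (polymap_ul_project v))).
  - by exists 0; rewrite gam0.
  - exact: (pp _ (polyfun_comp pf2 (polymap_ul_project v))).
  - by exists 1; rewrite gam1.
  - exact: (pp _ (polyfun_ul_det v)).
  - by exists 0; rewrite gam0.
  - exact: (polyfun_curve (polyfun_det (@polymap_id K n)) lb_poly).
  - by exists 0; rewrite /lb scale0r addr0.
  - exact: (polyfun_curve (polyfun_det (@polymap_id K n)) lc_poly).
  - by exists 0; rewrite /lc scale0r addr0.
have h1 := cP _ (or_introl erefl).
have h2 := cP _ (or_intror (or_introl erefl)).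
have h3 := cP _ (or_intror (or_intror (or_introl erefl))).
have h4 := cP _ (or_intror (or_intror (or_intror (or_introl erefl)))).
have h5 := cP _ (or_intror (or_intror (or_intror (or_intror (or_introl erefl))))).
rewrite -unitfE -unitmxE in h4; rewrite -unitfE -unitmxE in h5.
pose g := mulGL (mulGL (MkGL h4) (permGL K u)) (MkGL h5).
have Rg : richardson v u (to_flag (@ul_projectGL v (GLval g) h3)).
  exists g, h3; split=> //; exists (MkGL h4), (MkGL h5); split=> //; exact: trig_line.
by case: (sub _ Rg) => [/f1F|/f2F] /= E; [rewrite E eqxx in h1|rewrite E eqxx in h2].
Qed.

End Flags.

(** * Degenerations *)

Section Degeneration.
Variables (K : numFieldType) (n : nat).
Local Open Scope ring_scope.
Local Open Scope classical_set_scope.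
Local Notation GLval := Defs.GLval.
Implicit Types (u v w : 'S_n) (a b i j : 'I_n).

Local Notation P u := (GLval (permGL K u)).

Lemma permGLE u i j : P u i j = (i == u j)%:R.
Proof. by rewrite !mxE eq_sym. Qed.

Lemma permGL_mul_delta u i j : P u *m delta_mx i j = delta_mx (u i) j.
Proof.
apply/matrixP => x y; rewrite mxE (bigD1 i) //= big1 => [|k ki].
  by rewrite permGLE !mxE eqxx addr0 -natrM mulnb.
by rewrite [X in _ * X]mxE (negPf ki) mulr0.
Qed.

Lemma delta_mul_permGL u i j : delta_mx i (u j) *m P u = delta_mx i j.
Proof.
apply/matrixP => x y; rewrite mxE (bigD1 (u j)) //= big1 => [|k ki].
  by rewrite permGLE !mxE eqxx andbT addr0 -natrM mulnb (inj_eq perm_inj) [j == y]eq_sym.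
by rewrite [X in X * _]mxE (negPf ki) andbF mul0r.
Qed.

Lemma permGL_tperm u a b : a != b -> P (perm_comp u (tperm a b)) =
  P u - delta_mx (u a) a - delta_mx (u b) b + delta_mx (u b) a + delta_mx (u a) b.
Proof.
move=> ab; apply/matrixP => x y; rewrite !mxE !(eq_sym (_ y) x) perm_compE.
case: tpermP => [->|->|/eqP/negPf -> /eqP/negPf ->]; rewrite ?eqxx ?(negPf ab) ?[b == a]eq_sym ?(negPf ab).
- by rewrite ?andbT ?andbF; ring.
- by rewrite ?andbT ?andbF; ring.
- by rewrite ?andbT ?andbF; ring.
Qed.

(** The 2 x 2 identity placing the lower unipotent matrix with entry [c] in B s B, spread over rows
    [u a], [u b] and columns [a], [b]. The right factor has the block with rows (c, 1) and (0,
    -1/c). *)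
Lemma degeneration_factor u a b c : a != b -> c != 0 ->
  P u + c *: delta_mx (u b) a =
  (1%:M + c^-1 *: delta_mx (u a) (u b)) *m P (perm_comp u (tperm a b)) *m
  (1%:M + (c - 1) *: delta_mx a a + delta_mx a b - (1 + c^-1) *: delta_mx b b).
Proof.
move=> ab c0; rewrite -mulmxA.
set M := _ *m (_ + _ + _ - _).
have -> : M = P u - delta_mx (u a) a + c *: delta_mx (u b) a - c^-1 *: delta_mx (u a) b.
  rewrite /M mulmxBr !mulmxDr mulmx1 -!scalemxAr !permGL_mul_delta !perm_compE tpermL tpermR.
  rewrite (permGL_tperm _ ab); apply/matrixP => x y.
  by do ?[rewrite mxE]; ring.
rewrite mulmxDl mul1mx -scalemxAl !mulmxDr !mulmxN -!scalemxAr delta_mul_permGL.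
rewrite !mul_delta_mx_cond (inj_eq perm_inj) [b == a]eq_sym (negPf ab) eqxx mulr0n mulr1n.
by apply/matrixP => x y; do ?[rewrite mxE]; field.
Qed.

(** The inequalities [u a < u b] and [a < b] make the left and right factors upper triangular,
    respectively. *)
Lemma degeneration u a b c : up u a b -> c != 0 ->
  exists g, bruhat_double (perm_comp u (tperm a b)) g /\
            GLval g = P u + c *: delta_mx (u b) a.
Proof.
move=> /andP[ab uab] c0; have nab := ltn_neq ab; have nuab := ltn_neq uab.
set B1 := 1%:M + c^-1 *: delta_mx (u a) (u b) : 'M[K]_n.
set B2 := 1%:M + (c - 1) *: delta_mx a a + delta_mx a b - (1 + c^-1) *: delta_mx b b : 'M[K]_n.
have nE (i j : 'I_n) : (i < j)%N -> (i == j = false) * (j == i = false).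
  by move=> ij; have := ltn_neq ij; rewrite [j == i]eq_sym => /negPf ->.
have t1 : is_trig_mx B1^T.
  apply/is_trig_mxP => i j ij; rewrite !mxE !(nE _ _ ij).
  case: (eqVneq j (u a)) => [jE|_]; case: (eqVneq i (u b)) => [iE|_] /=; rewrite ?mulr0 ?addr0 //.
  by move: uab; rewrite -jE -iE ltnNge ltnW.
have t2 : is_trig_mx B2^T.
  apply/is_trig_mxP => i j ij; rewrite !mxE !(nE _ _ ij).
  have off k : (j == k) && (i == k) = false.
    by apply/negP => /andP[/eqP jk /eqP ik]; rewrite jk ik ltnn in ij.
  rewrite !off; case: (eqVneq j a) => [jE|_]; case: (eqVneq i b) => [iE|_] /=;
    rewrite ?mulr0 ?addr0 ?subr0 //.
  by move: ab; rewrite -jE -iE ltnNge ltnW.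
have u1 : B1 \in unitmx.
  rewrite -unitmx_tr unitmxE unitfE det_trig //; apply/prodf_neq0 => i _.
  rewrite !mxE eqxx; case: (eqVneq i (u a)) => [->|_]; rewrite ?(negPf nuab) /= mulr0 addr0 oner_neq0 //.
have u2 : B2 \in unitmx.
  rewrite -unitmx_tr unitmxE unitfE det_trig //; apply/prodf_neq0 => i _.
  rewrite !mxE eqxx; case: (eqVneq i a) => [->|_].
    by rewrite (negPf nab) /= mulr0 subr0 addr0 mulr1 addrC subrK.
  case: (eqVneq i b) => [_|_] /=; last by rewrite !mulr0 subr0 !addr0 oner_neq0.
  by rewrite !mulr0 !addr0 mulr1 opprD addrA subrr sub0r oppr_eq0 invr_neq0.
exists (mulGL (mulGL (MkGL u1) (permGL K (perm_comp u (tperm a b)))) (MkGL u2)).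
split; first by exists (MkGL u1), (MkGL u2).
by rewrite (degeneration_factor _ nab c0).
Qed.

Lemma closure_intro (T : topologicalType) (A : set T) x :
  (forall F, closed F -> A `<=` F -> F x) -> closure A x.
Proof. by move=> h; apply: h; [exact: closed_closure|exact: subset_closure]. Qed.

(** For g = b0 P_u c0, perturbing P_u by [c] at the entry [(u b, a)] gives a curve through g at
    [c = 0] that lies in the larger double coset for [c] nonzero. A polynomial vanishing on the
    larger piece vanishes at the projections for generic [c], hence also at [c = 0]. *)
Lemma richardson_up v u a b : up u a b ->
  @richardson K n v u `<=` closure (@richardson K n v (perm_comp u (tperm a b))).
Proof.
move=> upab _ [g [g0 [[b0 [c0 [bb0 bc0 gE]]] ->]]]; apply: closure_intro => F cF RF.
apply: contrapT => nF; have [f [pf fn fF]] := closed_flag_separate cF nF.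
pose gam c := GLval b0 *m (P u + c *: delta_mx (u b) a) *m GLval c0.
have gam_poly : forall i j, polycurve (fun c => gam c i j).
  apply: polycurve_mulmx => [|i j]; last exact: polycurve_const.
  apply: polycurve_mulmx => [i j|]; first exact: polycurve_const.
  exact: polycurve_line.
have gam0 : gam 0 = GLval g by rewrite /gam scale0r addr0 gE.
have pp h (ph : polyfun h) := polyfun_curve ph gam_poly.
have [|c cP] := @polycurves_nonzero K [:: id; fun c => ul_det v (gam c);
    fun c => f (ul_project v (gam c))].
  move=> _ /= [<-|[<-|[<-|//]]]; split.
  - exact: polycurve_id.
  - by exists 1; rewrite oner_neq0.
  - exact: (pp _ (@polyfun_ul_det K n v)).
  - by exists 0; rewrite gam0.
  - exact: (pp _ (polyfun_comp pf (@polymap_ul_project K n v))).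
  - by exists 0; rewrite gam0.
have h1 := cP _ (or_introl erefl).
have h2 := cP _ (or_intror (or_introl erefl)).
have h3 := cP _ (or_intror (or_intror (or_introl erefl))).
have [g' [[b1 [c1 [bb1 bc1 g'E]]] g'gam]] := degeneration upab h1.
have gamE : gam c = GLval (mulGL (mulGL b0 g') c0) by rewrite /gam -g'gam.
rewrite gamE in h2 h3; move/eqP: h3; apply.
apply: (richardson_in pf (fun h Rh => fF h (RF _ Rh)) _ h2).
exists (mulGL b0 b1), (mulGL c1 c0); split; [exact: borelM|exact: borelM|].
by rewrite g'E !mulGLA.
Qed.

Lemma closure_sub (T : topologicalType) (A B : set T) :
  A `<=` closure B -> closure A `<=` closure B.
Proof. by move=> AB; rewrite (closure_id (closure B)).1; [exact: closure_subset|exact: closed_closure]. Qed.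

Lemma richardson_bruhat v u w : bruhat u w ->
  @richardson K n v u `<=` closure (@richardson K n v w).
Proof.
move: u; apply: bruhat_ind => [|x y /bruhat_stepP[a [b [upx ->]]] _ IH].
  exact: subset_closure.
exact: subset_trans (richardson_up upx) (closure_sub IH).
Qed.

(** The closure of the piece contains the piece of [v] itself, which has a point. *)
Lemma richardson_neq0 v u : bruhat v u -> @richardson K n v u !=set0.
Proof.
move=> /(@richardson_bruhat v) sub; have [x /sub Rx] := @richardson_refl K n v.
apply/set0P/eqP => R0; move: Rx; rewrite R0 closure0 => //.
Qed.

End Degeneration.

(** * Strictness of the chain *)

Section Separation.
Variables (K : numFieldType) (n : nat).
Local Open Scope ring_scope.
Local Open Scope classical_set_scope.
Local Notation GLval := Defs.GLval.
Implicit Types (u v w : 'S_n) (a b i j : 'I_n).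

Local Notation P u := (GLval (permGL K u)).
Local Notation prefix a := (widen_ord (ltn_ord a)).

(** A Pluecker coordinate: the minor on the first [a.+1] columns, with the rows taken in the order
    prescribed by [w]. *)
Definition prefix_minor w a (A : 'M[K]_n) : K :=
  \det (\matrix_(x < a.+1, y < a.+1) A (w (prefix a x)) (prefix a y)).

Lemma polyfun_prefix_minor w a : polyfun (prefix_minor w a).
Proof.
apply: polyfun_det => x y.
by apply: eq_polyfun (@PolyCoord K n (w (prefix a x)) (prefix a y)) => A; rewrite mxE.
Qed.

Lemma prefix_minor_mul w a (A B : 'M[K]_n) : is_trig_mx B^T ->
  prefix_minor w a (A *m B) = prefix_minor w a A * prefix_minor 1 a B.
Proof.
move=> /is_trig_mxP tB; rewrite /prefix_minor -det_mulmx; congr (\det _).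
apply/matrixP => x y; rewrite !mxE.
rewrite (bigID (fun k : 'I_n => (k < a.+1)%N)) /= addrC big1 ?add0r => [|k]; last first.
  rewrite -leqNgt => ak; have := tB (prefix a y) k; rewrite mxE => ->; first by rewrite mulr0.
  exact: leq_trans (ltn_ord y) ak.
rewrite (big_ord_narrow (ltn_ord a)); apply: eq_bigr => k _.
by rewrite !mxE perm1.
Qed.

Lemma prefix_minor_permGL w a : prefix_minor w a (P w) = 1.
Proof.
rewrite /prefix_minor (_ : \matrix_(_, _) _ = 1%:M) ?det1 //.
by apply/matrixP => x y; rewrite !mxE (inj_eq perm_inj) eq_sym -val_eqE.
Qed.

(* A nonzero term of the Leibniz expansion would match the rows w(x) with rows u(s x) >= w(x),
   but the sum of the w(x) exceeds that of the u(x). *)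
Lemma prefix_minor_eq0 u a b (B : 'M[K]_n) : up u a b -> is_trig_mx B^T ->
  prefix_minor (perm_comp u (tperm a b)) a (B *m P u) = 0.
Proof.
move=> /andP[ab uab] /is_trig_mxP tB; set w := perm_comp u _.
rewrite /prefix_minor /determinant big1 // => s _.
have [x] : exists x : 'I_a.+1, (u (prefix a (s x)) < w (prefix a x))%N.
  apply/existsP; rewrite -[X in is_true X]negbK negb_exists; apply/negP => /forallP le.
  have : (\sum_(x < a.+1) w (prefix a x) <= \sum_(x < a.+1) u (prefix a x))%N.
    rewrite [X in (_ <= X)%N](reindex_inj (@perm_inj _ s)) leq_sum // => x _.
    by rewrite leqNgt.
  rewrite !big_ord_recr /= leqNgt => /negP; apply.
  have -> : prefix a ord_max = a by apply: val_inj.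
  rewrite [w a]perm_compE tpermL -addnS leq_add // leq_eqVlt.
  apply/orP; left; apply/eqP; apply: eq_bigr => x _.
  by rewrite perm_compE tpermD // eq_sym; apply: ltn_neq => /=; rewrite ?(ltn_trans _ ab).
move=> lt; rewrite (bigD1 x) //= mxE mxE (bigD1 (u (prefix a (s x)))) //= big1 => [|k ki].
  have := tB (u (prefix a (s x))) (w (prefix a x)) lt; rewrite mxE => ->.
  by rewrite mul0r addr0 mul0r mulr0.
by rewrite permGLE (negPf ki) mulr0.
Qed.

(** The flags at which all B-translates of one Pluecker coordinate vanish form a closed set. It
    contains the piece of [u], but no flag in the cell of [w], since the coordinate is 1 at the
    permutation matrix of [w]. *)
Lemma richardson_notin_closure v u a b x : up u a b ->
  richardson v (perm_comp u (tperm a b)) x -> ~ closure (@richardson K n v u) x.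
Proof.
move=> upab; set w := perm_comp u _ => Rx.
(* Letting [e] vary over B makes the vanishing condition independent of the representative of a
   flag; letting [d] vary makes it stable under the left action of B. *)
pose Fs := [set f : 'M[K]_n -> K | exists d e, [/\ borel d, borel e &
  f = fun A => prefix_minor w a (GLval d *m A *m GLval e)]].
pose Z : set (flag K n) := [set y | exists2 g, y = to_flag g & forall f, Fs f -> f (GLval g) = 0].
have cZ : closed Z.
  apply: (@closed_flag K n Fs) => [f [d [e [_ _ ->]]]|g].
    apply: polyfun_comp (polyfun_prefix_minor w a) _.
    apply: (polymap_mul _ (@polymap_const K n _ _ _)).
    exact: (polymap_mul (@polymap_const K n _ _ _) (@polymap_id K n)).
  split=> [[h /to_flag_eq[c bc hE] hZ] f [d [e [bd be ->]]]|gZ]; last by exists g.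
  have := hZ (fun A => prefix_minor w a (GLval d *m A *m GLval (mulGL (invGL c) e))).
  rewrite hE /= !mulmxA mulmxK ?GLvalP //; apply.
  by exists d, (mulGL (invGL c) e); split=> //; apply: borelM => //; exact: borelV.
have RZ : richardson v u `<=` Z.
  move=> _ /richardson_double[_ [d [e [bd be ->]]] ->].
  exists (mulGL (mulGL d (permGL K u)) e) => // f [d' [e' [bd' be' ->]]].
  set g := mulGL _ e.
  have -> : GLval d' *m GLval g *m GLval e' =
      GLval (mulGL d' d) *m P u *m GLval (mulGL e e') by rewrite /= !mulmxA.
  have bdd := borelM bd' bd; have bee := borelM be be'.
  by rewrite prefix_minor_mul // (prefix_minor_eq0 upab) // mul0r.
move=> /(closure_subset RZ); rewrite -(closure_id Z).1 // => -[h xh hZ].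
have [g [d [e [bd be gE]]] xg] := richardson_double Rx.
move: (xh); rewrite xg => /to_flag_eq[c bc hE].
have FG : Fs (fun A => prefix_minor w a (GLval (invGL d) *m A *m GLval (invGL (mulGL e c)))).
  by exists (invGL d), (invGL (mulGL e c)); split=> //; apply: borelV => //; exact: borelM.
have /eqP := hZ _ FG.
have -> : GLval (invGL d) *m GLval h *m GLval (invGL (mulGL e c)) = P w.
  rewrite -[LHS]/(GLval (mulGL (mulGL (invGL d) h) (invGL (mulGL e c)))).
  by rewrite hE gE -!mulGLA mulVGLK [mulGL e _]mulGLA mulGLA mulGLK.
by rewrite prefix_minor_permGL oner_eq0.
Qed.

Lemma saturated_chain_nth v us w (i : nat) : saturated_chain v us w -> (i <= size us)%N ->
  bruhat v (nth v (v :: us) i) /\ bruhat (nth v (v :: us) i) w.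
Proof.
move=> /andP[/(pathP v) pus /eqP lus] iu; split.
  elim: i iu => [_|i IH iu] /=; first exact: bruhat_refl.
  apply: bruhat_trans (IH (ltnW iu)) _; apply: bruhat_step1.
  exact: bruhat_cover_step (pus i iu).
rewrite -(subKn iu); have : (size us - i <= size us)%N by exact: leq_subr.
elim: (size us - i)%N => [_|d IH du].
  by rewrite subn0 -lus (last_nth v) bruhat_refl.
apply: bruhat_trans (IH (ltnW du)); apply: bruhat_step1.
rewrite -(subnSK du); apply: (bruhat_cover_step (pus _ _)).
by rewrite ltn_subrL (leq_ltn_trans _ du).
Qed.

Lemma richardson_sub_kl v u w : bruhat u w -> richardson v u `<=` kl_variety K v w.
Proof.
move=> uw x Rx; split; last exact: richardson_opp_cell Rx.
by apply: (closure_subset (@richardson_cell K n v w)); exact: (richardson_bruhat uw).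
Qed.

Lemma closure_irreducible_in (T : topologicalType) (R A : set T) :
  R `<=` A -> irreducible_set R -> irreducible_set (closure R `&` A).
Proof.
move=> RA [[x Rx] irr].
have sub : R `<=` closure R `&` A by move=> y Ry; split; [exact: subset_closure|exact: RA].
split=> [|F1 F2 c1 c2 s12]; first by exists x; exact: sub.
have clos F : closed F -> R `<=` F -> closure R `&` A `<=` F.
  by move=> cF /closure_subset; rewrite -(closure_id F).1 // => RF y [/RF].
by case: (irr F1 F2 c1 c2 (subset_trans sub s12)) => s; [left|right]; apply: clos.
Qed.

(** The closures of the pieces of the successive members of the chain; a point of each piece lies
    outside the closure of the preceding one. This bounds the Krull dimension below by the length of
    the chain. *)
Lemma saturated_chain_irreducible v us w : saturated_chain v us w ->
  exists Z, irreducible_chain (kl_variety K v w) (size us) Z.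
Proof.
move=> sat; pose U (i : nat) := nth v (v :: us) i.
exists (fun i : nat => closure (richardson v (U i)) `&` kl_variety K v w); split=> i iu.
  have [vU Uw] := saturated_chain_nth sat iu; split.
    apply: closure_irreducible_in; first exact: richardson_sub_kl.
    by apply: richardson_irreducible; exact: richardson_neq0.
  by exists (closure (richardson v (U i))) => //; exact: closed_closure.
have [vU U'w] := saturated_chain_nth sat iu.
have /bruhat_cover_step/bruhat_stepP[a [b [upab U'E]]] : bruhat_cover (U i) (U i.+1).
  by case/andP: sat => /(pathP v) h _; exact: h.
split.
  by apply: setSI; apply: closure_sub; rewrite U'E; exact: richardson_up.
have [x Rx] := @richardson_neq0 K n v _ vU.
move=> /(_ x) []; first by split; [exact: subset_closure|exact: (richardson_sub_kl U'w)].
by move=> xU _; move: Rx; rewrite -/(U i.+1) U'E => Rx; apply: (richardson_notin_closure upab Rx).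
Qed.

End Separation.

(** * Cycles *)

Lemma mem_porbit_fconnect (T : finType) (q : {perm T}) (a b : T) :
  (b \in porbit q a) = fconnect q a b.
Proof.
apply/porbitP/idP => [[k ->]|ab]; first by rewrite permX fconnect_iter.
by exists (findex q a b); rewrite permX iter_findex.
Qed.

(* The successor of a in the cycles of the statement is its predecessor under the product of
   transpositions, whence the reversal. *)
Lemma porbit_cycle n (v w q : 'S_n) (A : {set 'I_n}) : w = perm_comp v q ->
  (exists a, A = porbit q a) <->
  exists s : seq 'I_n, [/\ s != [::], uniq s, A = [set a in s]%SET &
    path.cycle (fun a b : 'I_n => v a == w b) s].
Proof.
move=> wE; have cE s : path.cycle (fun a b : 'I_n => v a == w b) s = fcycle q (rev s).
  by rewrite rev_cycle; apply: eq_cycle => a b; rewrite /= wE perm_compE (inj_eq perm_inj) eq_sym.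
split=> [[a ->]|[s [s0 us -> cs]]].
  exists (rev (fingraph.orbit q a)); split.
  - by rewrite -size_eq0 size_rev size_orbit -lt0n fingraph.order_gt0.
  - by rewrite rev_uniq orbit_uniq.
  - by apply/setP => b; rewrite inE mem_rev mem_porbit_fconnect fconnect_orbit.
  - by rewrite cE revK cycle_orbit //; exact: perm_inj.
have [a as_] : exists a, a \in s by case: s s0 {us cs} => [//|a s] _; exists a; rewrite mem_head.
exists a; apply/setP => b; rewrite inE mem_porbit_fconnect fconnect_orbit.
by rewrite cE in cs; rewrite (fingraph.orbitE cs) ?rev_uniq ?mem_rot ?mem_rev.
Qed.

Lemma connect_tperm_product n (e : rel 'I_n) (es : seq ('I_n * 'I_n)) : symmetric e ->
  (forall p, p \in es -> e p.1 p.2) -> forall a, connect e a (tperm_product es a).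
Proof.
move=> esym; elim: es => [|[c d] es IH] ese a; first by rewrite /= perm1 connect0.
rewrite /= perm_compE; apply: (connect_trans (IH _ a)) => [p pes|].
  by apply: ese; rewrite inE pes orbT.
have cd : e c d by apply: (ese (c, d)); rewrite mem_head.
case: tpermP => [->|->|_ _]; [exact: connect1|by apply: connect1; rewrite esym|exact: connect0].
Qed.

(** The product of transpositions moves every vertex within its component. Conversely, the indicator
    function of an orbit is invariant, so by Carter's lemma it is constant along edges and no edge
    leaves the orbit. *)
Lemma connect_porbit (R : realType) n (v : 'S_n) (e : rel 'I_n) (es : seq ('I_n * 'I_n)) :
  free [seq edge_vector R v p | p <- es] -> symmetric e ->
  (forall p, p \in es -> e p.1 p.2) ->
  (forall a b, e a b -> (a, b) \in es \/ (b, a) \in es) ->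
  forall a b, connect e a b = (b \in porbit (tperm_product es) a).
Proof.
move=> fr esym ese ees a b; set q := tperm_product es; apply/idP/idP; last first.
  case/porbitP => k ->; elim: k => [|k IH]; first by rewrite perm1 connect0.
  by rewrite expgSr permM (connect_trans IH) // connect_tperm_product.
pose f (i : 'I_n) : R := (i \in porbit q a)%:R%R.
have fq i : f (q i) = f i.
  by rewrite /f !mem_porbit_fconnect -same_fconnect1_r //; exact: perm_inj.
have fes := free_edges_fixed fr fq.
have fe c d : e c d -> f c = f d by case/ees => [/fes|/fes].
have fpath c p : path e c p -> f (last c p) = f c.
  by elim: p c => //= d p IH c /andP[cd dp]; rewrite IH ?(fe c d).
case/connectP => p /fpath + ->.
by rewrite /f porbit_id; case: (_ \in _) => // /eqP; rewrite eq_sym oner_eq0.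
Qed.

(** The length is at most the Krull dimension, which equals the cone dimension by toricness, which
    is at most the dimension of the span of the edge vectors. That many vectors spanning a space of
    at least that dimension are independent. *)
Lemma toric_free (R : realType) n (v w : 'S_n) us es : saturated_chain v us w ->
  kl_toric R v w -> size es = size us ->
  (forall a b, chain_graph v us a b -> (a, b) \in es \/ (b, a) \in es) ->
  free [seq edge_vector R v p | p <- es].
Proof.
move=> sat tor sz Ges.
have cone_le := cone_dim_le (@weight_cone_sub R n v us w es sat Ges).
have le_dim : ((size us)%:R%:E <= krull_dim R (kl_variety R[i] v w))%E.
  apply: ereal_sup_ubound; exists (size us) => //.
  exact: saturated_chain_irreducible.
have le_cone : (size us <= cone_dim (weight_cone R v w))%N.
  move: tor le_dim; rewrite /kl_toric /kl_complexity.
  (* An infinite Krull dimension is excluded, as the complexity would not be 0. *)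
  case: (krull_dim _ _) => [r||] //=; rewrite ?leeNy_eq //.
  rewrite -EFinB => -[/eqP]; rewrite subr_eq0 => /eqP ->.
  by rewrite lee_fin ler_nat.
rewrite /free eqn_leq dim_span size_map sz /=.
exact: leq_trans le_cone cone_le.
Qed.

Theorem lemma3p25 (R : realType) (n : nat) (v w : 'S_n) (us : seq 'S_n) :
  bruhat v w ->
  saturated_chain v us w ->
  kl_toric R v w ->
  forall A : {set 'I_n},
    A \in components (chain_graph v us) <->
    exists s : seq 'I_n,
      [/\ s != [::], uniq s, A = [set a in s]%SET
        & path.cycle (fun a b : 'I_n => v a == w b) s].
Proof.
move=> _ sat tor A; have [es [sz wE esG Ges]] := chain_edges sat.
have cE := connect_porbit (toric_free sat tor sz Ges) (@chain_graph_sym n v us) esG Ges.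
rewrite -(porbit_cycle A wE); rewrite /components /equivalence_partition.
split=> [/imsetP[a _ ->]|[a ->]]; [exists a|apply/imsetP; exists a => //];
  by apply/setP => b; rewrite !inE cE.
Qed.
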